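(* Let $D$ be a local domain with quotient field $F$, and let $F', \theta_1,\ldots,\theta_n, D', A_V, \mathcal{F}$ be data as described in the context (in particular $\bigcap_{V} A_V = D$). Let $R := Kr^{\mathcal{F}}(D) = \bigcap_{A \in \mathcal{F}} A(t)$. Then $\overline{R} = Kr(\overline{D})$, and all the localizations of $R$ at its maximal ideals are of the form $R_{\mathfrak{p}} = A_V(t)$, where $\mathfrak{p} = \mathfrak{m}_{A_V(t)} \cap R$ and $V$ is a valuation overring of $D'$ with $\mathfrak{m}_V \supseteq \mathfrak{m}_{D'}$.
   Context: General notation. An overring of a domain $D$ is a ring between $D$ and its quotient field $\mathcal{Q}(D)$. The maximal ideal of a local ring $A$ is $\mathfrak{m}_A$ (''local'': unique maximal ideal). $\overline{D}$ is the integral closure of $D$ in its quotient field and $\overline{D}^{F}$ its integral closure in a field $F$. For a domain $A$ and an indeterminate $t$, the Nagata ring is $A(t)=\{f/g : f,g\in A[t],\ c(g)=A\}$, $c(g)$ being the ideal of $A$ generated by the coefficients of $g$. For an integrally closed domain $D$, $Kr(D)=\bigcap_V V(t)$, $V$ ranging over the valuation overrings of $D$ centered on maximal ideals of $D$ (equivalently, over all valuation overrings). A domain $D$ is maximal excluding if there is $\alpha\in\mathcal{Q}(D)\setminus D$ such that every overring of $D$ strictly containing $D$ contains $\alpha$. A defining family of $D$ is a collection $\mathcal{F}$ of overrings of $D$ with $\bigcap_{A\in\mathcal{F}}A=D$, and $Kr^{\mathcal{F}}(D)=\bigcap_{A\in\mathcal{F}}A(t)$. All rings are assumed to have finite Krull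 dimension. The construction. $D$ is a local domain with quotient field $F$. $F'$ is a subfield of $F$ with $\mathbb{Q}\subseteq F'$ such that $F/F'$ is a finite Galois extension of degree $n$, generated as an $F'$-vector space by $\theta_1=1,\theta_2,\ldots,\theta_n$. $K$ is the field generated over $\mathbb{Q}$ by $\theta_1,\ldots,\theta_n$ and all their conjugates under $\mathrm{Gal}(F/F')$. It is assumed that any intermediate extension $E/E'$ with $F'\subseteq E'\subseteq E\subseteq F$ is a Galois extension generated by elements $\vartheta_1,\ldots,\vartheta_m$ and satisfies one of the following conditions: ($*_1$) $K\subseteq\overline{D}$; ($*_2$) $\{\vartheta_1,\ldots,\vartheta_m\}=\{1,\vartheta,\vartheta^2,\ldots,\vartheta^{m-1}\}$ where $\vartheta$ is a simple root (radical) of degree $m$ over $E'$, i.e. $\vartheta^m\in E'$, and $\overline{D}$ contains $\xi\vartheta^m$ for every $m$-th root of unity $\xi$. Suppose there is a local integrally closed domain $D'$ containing $\mathbb{Q}$, with quotient field $F'$, such that $\mathfrak{m}_{D'}\subseteq\mathfrak{m}_D$, $D=D'[\mathfrak{m}_D]_{\mathfrak{m}_D}$, and $\overline{D'}^{F}=\overline{D}=D[\theta_1,\ldots,\theta_n]$. For a valuation overring $V$ of $D'$ with $\mathfrak{m}_V\supseteq\mathfrak{m}_{D'}$ define $A_V:=V[\mathfrak{m}_D]_{(\mathfrak{m}_V,\mathfrak{m}_D)}$, the localization of the ring $V[\mathfrak{m}_D]$ generated by $V$ and $\mathfrak{m}_D$ at the ideal generated by $\mathfrak{m}_V$ and $\mathfrak{m}_D$.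 Suppose $\bigcap_V A_V=D$, the intersection being over all such $V$. $\mathcal{F}$ is the defining family of $D$ consisting of all the maximal excluding overrings $A$ of $D$ such that $A\supseteq A_V$ for some such $V$. *)

(* Defs.v *)
From HB Require Import structures.
From mathcomp Require Import all_boot all_order all_fingroup all_algebra all_field.
From mathcomp Require Import boolp classical_sets.

Set Implicit Arguments.
Unset Strict Implicit.
Unset Printing Implicit Defensive.

Import GRing.Theory.

Local Open Scope classical_set_scope.
Local Open Scope ring_scope.

(* Every domain is given as a subset A of an ambient field K, which may be
   larger than the quotient field of A. *)
Section Rings.
Variable K : fieldType.
Implicit Types (A B V I M P S F : set K) (x a s : K).

Definition subring A : Prop := GRing.subring_closed [in A].

Definition quotient_field A : set K :=
  [set x | exists a s, [/\ A a, A s, s != 0 & x = a / s]].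

Definition overring A B : Prop :=
  [/\ subring B, A `<=` B & B `<=` quotient_field A].

Definition ring_gen S : set K := smallest subring S.

Definition field_gen S : set K :=
  smallest (fun E : set K => GRing.divring_closed [in E]) S.

Definition ideal A I : Prop :=
  [/\ I `<=` A, I 0,
      forall x y, I x -> I y -> I (x + y)
    & forall a x, A a -> I x -> I (a * x)].

Definition ideal_gen A S : set K := smallest (ideal A) S.

Definition prime_ideal A P : Prop :=
  [/\ ideal A P, ~ P 1
    & forall x y, A x -> A y -> P (x * y) -> P x \/ P y].

Definition maximal_ideal A M : Prop :=
  [/\ ideal A M, ~ M 1
    & forall I, ideal A I -> M `<=` I -> I = M \/ I = A].

Definition local_ring A : Prop :=
  subring A /\ exists! M, maximal_ideal A M.

(* The union has a single term when A is local; it is used only for such A. *)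
Definition max_of A : set K := \bigcup_(M in maximal_ideal A) M.

Definition finite_krull_dim A : Prop :=
  exists d : nat, forall (n : nat) (P : 'I_n.+1 -> set K),
    (forall i, prime_ideal A (P i)) ->
    (forall i j : 'I_n.+1, (i < j)%N -> P i `<` P j) -> (n <= d)%N.

Definition localization A P : set K :=
  [set x | exists a s, [/\ A a, A s, ~ P s, s != 0 & x = a / s]].

Definition integral_over A x : Prop :=
  exists p : {poly K}, [/\ p \is monic, p \is a polyOver [in A] & root p x].

Definition integral_closure A F : set K := [set x | F x /\ integral_over A x].

Definition normalization A : set K := integral_closure A (quotient_field A).

Definition integrally_closed A : Prop := normalization A = A.

Definition valuation_ring V : Prop :=
  subring V /\ forall x, quotient_field V x -> V x \/ V x^-1.

Definition valuation_overring A V : Prop := overring A V /\ valuation_ring V.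

Definition maximal_excluding A : Prop :=
  exists alpha, [/\ quotient_field A alpha, ~ A alpha
    & forall B, overring A B -> A `<` B -> B alpha].

Definition content A (g : {poly K}) : set K :=
  ideal_gen A [set c | c \in (g : seq K)].

Definition nagata A : set {fraction {poly K}} :=
  [set h | exists f g : {poly K},
    [/\ f \is a polyOver [in A], g \is a polyOver [in A],
        content A g = A & h = tofrac f / tofrac g]].

Definition Kr A : set {fraction {poly K}} :=
  \bigcap_(V in [set V | valuation_overring A V /\
                         maximal_ideal A (max_of V `&` A)]) nagata V.

Definition Kr_family (Fam : set (set K)) : set {fraction {poly K}} :=
  \bigcap_(A in Fam) nagata A.

(* The valuation overrings V of the local domain D' with m_V containing
   m_D', and the rings A_V. *)
Definition dominating_valuation (D' V : set K) : Prop :=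
  valuation_overring D' V /\ max_of D' `<=` max_of V.

Definition A_of (D V : set K) : set K :=
  let B := ring_gen (V `|` max_of D) in
  localization B (ideal_gen B (max_of V `|` max_of D)).

Definition maximal_excluding_family (D D' : set K) : set (set K) :=
  [set A | [/\ overring D A, maximal_excluding A
    & exists2 V, dominating_valuation D' V & A_of D V `<=` A]].

End Rings.

Section Extension.
Variables (F0 : fieldType) (L : splittingFieldType F0).
Local Open Scope group_scope.

(* The field generated over Q by theta and all its conjugates over F0; in
   characteristic 0 every subfield of L contains Q. *)
Definition conjugate_field (theta : seq L) : set L :=
  field_gen [set x : L | exists s : gal_of {:L},
    exists t : L, [/\ s \in 'Gal({:L} / 1), t \in theta & x = s t]].

(* m is the number of generators; it is not required to be [E : E'].  Roots of
   unity are taken in L (when m = [E : E'], all of them lie in E). *)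
Definition radical_condition (Dbar : set L) (E' : {subfield L}) (vs : seq L) :
    Prop :=
  let m := size vs in
  exists v : L,
    [/\ vs =i [seq (v ^+ i)%R | i <- iota 0 m], (v ^+ m)%R \in E'
      & forall xi : L, (xi ^+ m = 1)%R -> Dbar (xi * v ^+ m)%R].

(* vs generates E as a vector space over E'. *)
Definition intermediate_condition (Dbar Kc : set L) : Prop :=
  forall E' E : {subfield L}, (E' <= E)%VS ->
    galois E' E /\
    exists vs : seq L, (E' * <<vs>>)%VS = E /\
      (Kc `<=` Dbar \/ radical_condition Dbar E' vs).

End Extension.

(* Main.v *)
Require Import Defs.
From HB Require Import structures.
From mathcomp Require Import all_boot all_order all_fingroup all_algebra all_field.
From mathcomp Require Import boolp classical_sets generic_quotient ring.

(* All A_V are local, and taking norms writes every element of F(t) as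
   f/g with g over F'; scaling makes g primitive over a given V. For such a g,
   f/g lies in A(t) iff f lies in A[t], for every local overring A of V, so that
   R is the intersection of all A_V(t). Since g_i/g lies in R for every g over
   F', a valuation ring Omega containing R and dominating its Jacobson radical
   restricts to some V in the family with A_V(t) in Omega. By Chevalley's theorem such
   Omega detect integrality over R, and one of them dominates any given maximal
   ideal p; there R_p contains V, m_D, t and the inverses of primitive
   polynomials over V, hence A_V(t). *)

Set Implicit Arguments.
Unset Strict Implicit.

Import GRing.Theory.

Local Open Scope classical_set_scope.
Local Open Scope ring_scope.

(** * Subrings, ideals and local rings of a field *)

Section Subrings.
Context {K : fieldType}.
Implicit Types (A B I J M S V : set K) (x y : K) (f g p q : {poly K}).

(** Nothing makes [A_V] a valuation ring, so a polynomial over it cannot simply be scaled to a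
    primitive one. Only [V] has comparable elements, and only inside F'. Norms move the denominators
    into F'[t], where the scaling is done over [V], while the numerators stay arbitrary. Reading off
    the numerator then needs a Gauss lemma over local domains that need not be integrally closed; it
    comes from Nakayama's lemma. The Jacobson radical enters because the family contains only those
    [V] that dominate D': a valuation ring that merely contains R might induce a smaller centre on
    D'. The radical contains m_D, so dominating it fixes the centre. *)

Lemma subringP A :
  subring A <-> [/\ A 1, forall x y, A x -> A y -> A (x - y)
                   & forall x y, A x -> A y -> A (x * y)].
Proof.
have E x : (x \in [in A]) <-> A x by rewrite inE.
split=> [[/E A1 AB AM]|[A1 AB AM]]; split=> //; try exact/E.
- by move=> x y /E Ax /E Ay; apply/E/AB.
- by move=> x y /E Ax /E Ay; apply/E/AM.
- by move=> x y /E Ax /E Ay; apply/E/AB.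
- by move=> x y /E Ax /E Ay; apply/E/AM.
Qed.

Lemma subring1 {A} : subring A -> A 1. Proof. by case/subringP. Qed.

Lemma subringB {A} x y : subring A -> A x -> A y -> A (x - y).
Proof. by case/subringP=> _ + _; apply. Qed.

Lemma subringM {A} x y : subring A -> A x -> A y -> A (x * y).
Proof. by case/subringP=> _ _; apply. Qed.

Lemma subring0 {A} : subring A -> A 0.
Proof. by move=> hA; rewrite -(subrr 1); apply: subringB => //; apply: subring1. Qed.

Lemma subringN {A} x : subring A -> A x -> A (- x).
Proof. by move=> hA Ax; rewrite -sub0r; apply: subringB => //; apply: subring0. Qed.

Lemma subringD {A} x y : subring A -> A x -> A y -> A (x + y).
Proof. by move=> hA Ax Ay; rewrite -(opprK y); apply: subringB => //; apply: subringN. Qed.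

Lemma subringX {A} x k : subring A -> A x -> A (x ^+ k).
Proof.
move=> hA Ax; elim: k => [|k IH]; first exact: subring1.
by rewrite exprS; apply: subringM.
Qed.

Lemma subring_sum {A} {I : Type} {r : seq I} {P : pred I} {F : I -> K} :
  subring A -> (forall i, P i -> A (F i)) -> A (\sum_(i <- r | P i) F i).
Proof.
move=> hA hF; elim/big_ind: _ => //; first exact: subring0.
by move=> x y; apply: subringD.
Qed.

Lemma idealN {A I} x : subring A -> ideal A I -> I x -> I (- x).
Proof.
move=> hA [_ _ _ IM] Ix; rewrite -mulN1r; apply: IM => //.
by apply: subringN => //; apply: subring1.
Qed.

Lemma idealB {A I} x y : subring A -> ideal A I -> I x -> I y -> I (x - y).
Proof. by move=> hA hI Ix Iy; case: (hI) => _ _ ID _; apply: ID => //; apply: idealN hA hI Iy. Qed.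

Lemma ideal_sum {A I} {T : Type} {r : seq T} {P : pred T} {F : T -> K} :
  ideal A I -> (forall i, P i -> I (F i)) -> I (\sum_(i <- r | P i) F i).
Proof. by move=> [_ I0 ID _] hF; elim/big_ind: _ => //. Qed.

Lemma ideal_full {A I} : ideal A I -> I 1 -> I = A.
Proof.
move=> [IA _ _ IM] I1; apply/seteqP; split=> // x Ax.
by rewrite -[x]mulr1; apply: IM.
Qed.

Lemma ideal_refl {A} : subring A -> ideal A A.
Proof.
move=> hA; split=> //; first exact: subring0.
- by move=> x y; apply: subringD.
- by move=> x y; apply: subringM.
Qed.

Lemma ideal_1B_expr A J x k : subring A -> ideal A J -> J x -> J (1 - (1 - x) ^+ k).
Proof.
move=> hA hJ Jx; have [JA J0 JD JM] := hJ.
elim: k => [|k IH]; first by rewrite expr0 subrr.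
have -> : 1 - (1 - x) ^+ k.+1 = (1 - (1 - x) ^+ k) + (1 - x) ^+ k * x.
  by rewrite exprSr; ring.
apply: JD => //; apply: JM => //; apply: subringX => //.
by apply: subringB; [|exact: subring1|exact: JA].
Qed.

Lemma ideal_gen_ideal {A S} : subring A -> S `<=` A -> ideal A (ideal_gen A S).
Proof.
move=> hA SA; split.
- by move=> x; apply; split=> //; apply: ideal_refl.
- by move=> I [[]].
- by move=> x y hx hy I hI; case: (hI) => -[_ _ ID _] _; apply: ID; [apply: hx|apply: hy].
- by move=> a x Aa hx I hI; case: (hI) => -[_ _ _ IM] _; apply: IM => //; apply: hx.
Qed.

Lemma sub_ideal_gen A S : S `<=` ideal_gen A S.
Proof. by move=> x Sx I [_]; apply. Qed.

Lemma ideal_gen_min {A S I} : ideal A I -> S `<=` I -> ideal_gen A S `<=` I.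
Proof. by move=> hI SI x; apply. Qed.

Lemma subring_ring_gen S : subring (ring_gen S).
Proof.
apply/subringP; split.
- by move=> A [hA _]; apply: subring1.
- by move=> x y hx hy A hA; apply: subringB; [case: hA|apply: hx|apply: hy].
- by move=> x y hx hy A hA; apply: subringM; [case: hA|apply: hx|apply: hy].
Qed.

Lemma sub_ring_gen S : S `<=` ring_gen S.
Proof. by move=> x Sx A [_]; apply. Qed.

Lemma ring_gen_min {S A} : subring A -> S `<=` A -> ring_gen S `<=` A.
Proof. by move=> hA SA x; apply. Qed.

(* [Zorn_bigcup] also asks for the union of the empty chain, hence this variant. *)
Lemma Zorn_above {T : Type} (good : set T -> Prop) (A0 : set T) :
  good A0 ->
  (forall F : set (set T), F !=set0 -> (forall B : set T, F B -> good B /\ A0 `<=` B) ->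
     total_on F subset -> good (\bigcup_(X in F) X)) ->
  exists A : set T, [/\ good A, A0 `<=` A & forall B : set T, A `<` B -> ~ good B].
Proof.
move=> g0 hF.
pose P := [set X : set T | good (A0 `|` X)].
have [F FP Ftot|A [PA Amax]] := @Zorn_bigcup _ P.
  rewrite /P/=; have [->|/set0P F0] := eqVneq F set0.
    by rewrite bigcup_set0 setU0.
  have -> : A0 `|` \bigcup_(X in F) X = \bigcup_(X in [set A0 `|` X | X in F]) X.
    apply/seteqP; split=> x.
      case: F0 => X FX [A0x|[Y FY Yx]]; [exists (A0 `|` X)|exists (A0 `|` Y)].
      - by exists X.
      - by left.
      - by exists Y.
      - by right.
    by case=> _ [X FX <-] [?|?]; [left|right; exists X].
  apply: hF.
  - by case: F0 => X FX; exists (A0 `|` X), X.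
  - by move=> _ [X FX <-]; split; [apply: FP|apply: subsetUl].
  - by move=> _ _ [X FX <-] [Y FY <-]; case: (Ftot _ _ FX FY) => h; [left|right];
      apply: setUS.
exists (A0 `|` A); split=> //.
move=> B AB gB; apply: (Amax B).
  split=> [x Ax|BA]; first by case: AB => + _; apply; right.
  by case: AB => _; apply=> x Bx; right; apply: BA.
rewrite /P/= (_ : A0 `|` B = B) //.
by apply/seteqP; split=> [x [?|//]|x ?]; [case: AB => + _; apply; left|right].
Qed.

Lemma chain2 {T : Type} {F : set (set T)} {X Y : set T} {x y : T} :
  total_on F subset -> F X -> F Y -> X x -> Y y ->
  exists Z, [/\ F Z, Z x & Z y].
Proof.
move=> Ft FX FY Xx Yy; case: (Ft _ _ FX FY) => h.
  by exists Y; split=> //; apply: h.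
by exists X; split=> //; apply: h.
Qed.

Lemma ideal_bigcup {A} (F : set (set K)) : F !=set0 ->
  (forall I, F I -> ideal A I) -> total_on F subset ->
  ideal A (\bigcup_(I in F) I).
Proof.
move=> [I0 FI0] hF Ft; split.
- by move=> x [I FI Ix]; case: (hF _ FI) => + _ _ _; apply.
- by exists I0 => //; case: (hF _ FI0).
- move=> x y [I FI Ix] [J FJ Jy]; have [Z [FZ Zx Zy]] := chain2 Ft FI FJ Ix Jy.
  by exists Z => //; case: (hF _ FZ) => _ _ + _; apply.
- by move=> a x Aa [I FI Ix]; exists I => //; case: (hF _ FI) => _ _ _; apply.
Qed.

Lemma subring_bigcup (F : set (set K)) : F !=set0 ->
  (forall A, F A -> subring A) -> total_on F subset ->
  subring (\bigcup_(A in F) A).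
Proof.
move=> [A0 FA0] hF Ft; apply/subringP; split.
- by exists A0 => //; apply: subring1; apply: hF.
- move=> x y [I FI Ix] [J FJ Jy]; have [Z [FZ Zx Zy]] := chain2 Ft FI FJ Ix Jy.
  by exists Z => //; apply: subringB => //; apply: hF.
- move=> x y [I FI Ix] [J FJ Jy]; have [Z [FZ Zx Zy]] := chain2 Ft FI FJ Ix Jy.
  by exists Z => //; apply: subringM => //; apply: hF.
Qed.

Lemma maximal_ideal_exists A I :
  ideal A I -> ~ I 1 -> exists2 M, maximal_ideal A M & I `<=` M.
Proof.
move=> hI I1.
have [] := @Zorn_above _ (fun J => ideal A J /\ ~ J 1) I.
- by [].
- move=> F F0 hF Ft; split; first by apply: ideal_bigcup => // J /hF[[]].
  by case=> J /hF[[_ J1] _] /J1.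
- move=> M [[hM M1] IM Mmax]; exists M => //; split=> // J hJ MJ.
  have [J1|J1] := pselect (J 1); first by right; apply: ideal_full.
  left; apply/eqP/negPn/negP => /eqP MJn; apply: (Mmax J) => //.
  by split=> // JM; apply: MJn; apply/seteqP.
Qed.

Lemma quotient_field_sub A : subring A -> A `<=` quotient_field A.
Proof.
move=> hA x Ax; exists x, 1; rewrite divr1 oner_eq0; split=> //; exact: subring1.
Qed.

Lemma quotient_fieldS A B : A `<=` B -> quotient_field A `<=` quotient_field B.
Proof. by move=> AB x [a [s [Aa As s0 ->]]]; exists a, s; split=> //; apply: AB. Qed.

Definition ring_unit A x := x != 0 /\ A x^-1.

Definition nonunits A := [set x | A x /\ ~ ring_unit A x].

(** Locality stated on elements, without maximal ideals, which makes it easy to check for [A_V] and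
    for Nagata rings. It agrees with [local_ring] by [localr_local_ring] and [local_ring_localr]. *)
Definition localr A :=
  subring A /\ forall x, A x -> ring_unit A x \/ ring_unit A (1 - x).

Lemma ring_unit1 A : subring A -> ring_unit A 1.
Proof. by move=> hA; split; [rewrite oner_eq0|rewrite invr1; apply: subring1]. Qed.

Lemma ring_unitM A x y :
  subring A -> ring_unit A x -> ring_unit A y -> ring_unit A (x * y).
Proof.
move=> hA [x0 Ax] [y0 Ay]; split; first by rewrite mulf_neq0.
by rewrite invfM; apply: subringM.
Qed.

Lemma ring_unit_mull A x y :
  subring A -> A y -> ring_unit A (x * y) -> ring_unit A x.
Proof.
move=> hA Ay []; rewrite mulf_eq0 negb_or => /andP[x0 y0].
move=> h; split=> //.
have -> : x^-1 = y * (x * y)^-1 by field; rewrite x0 y0.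
exact: subringM.
Qed.

Lemma ring_unitS A B x : A `<=` B -> ring_unit A x -> ring_unit B x.
Proof. by move=> AB [x0 /AB]. Qed.

Lemma nonunits1 A : subring A -> ~ nonunits A 1.
Proof. by move=> hA [_]; apply; apply: ring_unit1. Qed.

Lemma nonunits_ideal A : localr A -> ideal A (nonunits A).
Proof.
move=> [hA hl]; split.
- by move=> x [].
- by split; [apply: subring0|case; rewrite eqxx].
- move=> x y [Ax ux] [Ay uy]; split; first exact: subringD.
  move=> [s0 As].
  (* If [x + y] is a unit, then [x / (x + y)] and [y / (x + y)] sum to 1, so one of them is a unit,
     and with it [x] or [y]. *)
  have Ax' : A (x / (x + y)) by apply: subringM.
  case: (hl _ Ax') => h.
    by apply: ux; apply: ring_unit_mull h.
  apply: uy; apply: (@ring_unit_mull _ _ (x + y)^-1) => //.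
  by have <- : 1 - x / (x + y) = y / (x + y) by field.
- move=> a x Aa [Ax ux]; split; first exact: subringM.
  by rewrite mulrC => h; apply: ux; apply: ring_unit_mull h.
Qed.

Lemma maximal_ideal_localr A M :
  localr A -> maximal_ideal A M <-> M = nonunits A.
Proof.
move=> lA; have hN := nonunits_ideal lA; case: (lA) => hA hl.
have proper I : ideal A I -> ~ I 1 -> I `<=` nonunits A.
  move=> [IA _ _ IM] I1 x Ix; split; first exact: IA.
  by move=> [x0 Ax]; apply: I1; rewrite -(mulVf x0); apply: IM.
split=> [[hM M1 Mmax]|->].
  case: (Mmax _ hN (proper _ hM M1)) => // NA.
  by case: (nonunits1 hA); rewrite NA; apply: subring1.
split=> //; first exact: nonunits1.
move=> I hI NI; have [I1|I1] := pselect (I 1).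
  by right; apply: ideal_full.
by left; apply/seteqP; split=> //; apply: proper.
Qed.

Lemma localr_local_ring A : localr A -> local_ring A.
Proof.
move=> lA; split; first by case: lA.
exists (nonunits A); split; first exact/maximal_ideal_localr.
by move=> M /(maximal_ideal_localr _ lA).
Qed.

Lemma max_of_localr A : localr A -> max_of A = nonunits A.
Proof.
move=> lA; apply/seteqP; split=> x.
  by case=> M /(maximal_ideal_localr _ lA) ->.
by move=> Nx; exists (nonunits A) => //; apply/maximal_ideal_localr.
Qed.

Lemma local_ring_localr A : local_ring A -> localr A.
Proof.
move=> [hA [M [hM Muniq]]]; split=> // x Ax.
have key y : A y -> ~ ring_unit A y -> M y.
  move=> Ay uy.
  have hI : ideal A [set a * y | a in A].
    split.
    - by move=> _ [a Aa <-]; apply: subringM.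
    - by exists 0; rewrite ?mul0r //; apply: subring0.
    - by move=> _ _ [a Aa <-] [b Ab <-]; exists (a + b); [apply: subringD|rewrite mulrDl].
    - by move=> c _ Ac [a Aa <-]; exists (c * a); [apply: subringM|rewrite mulrA].
  have [|N hN IN] := maximal_ideal_exists hI.
    case=> a Aa ay1; apply: uy; rewrite /ring_unit.
    have y0 : y != 0 by apply/eqP=> y0; move: ay1; rewrite y0 mulr0 => /esym/eqP; rewrite oner_eq0.
    by split=> //; rewrite (_ : y^-1 = a) //; apply: (mulIf y0); rewrite mulVf.
  rewrite (Muniq _ hN); apply: IN; exists 1; rewrite ?mul1r //; exact: subring1.
have [|ux] := pselect (ring_unit A x); first by left.
have [|ux'] := pselect (ring_unit A (1 - x)); first by right.
case: (hM) => -[_ _ MD _] M1 _; case: M1.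
rewrite -(subrK x 1); apply: MD; apply: key => //.
by apply: subringB => //; apply: subring1.
Qed.

Lemma local_ring_unit1B A x : localr A -> nonunits A x -> ring_unit A (1 - x).
Proof. by move=> [_ hl] [Ax ux]; case: (hl _ Ax). Qed.

(** Compare [x] with [1 - x]: adding 1 to whichever quotient of the two lies in [V] gives the
    inverse of [1 - x] or of [x]. *)
Lemma valuation_ring_localr V : valuation_ring V -> localr V.
Proof.
move=> [hV hv]; split=> // x Vx.
have [->|x0] := eqVneq x 0; first by rewrite subr0; right; apply: ring_unit1.
have [E|x1] := eqVneq (1 - x) 0.
  have -> : x = 1 by apply/eqP; rewrite eq_sym -subr_eq0 E.
  by left; apply: ring_unit1.
have V1 := subring1 hV.
case: (hv (x / (1 - x))).
- by exists x, (1 - x); split=> //; apply: subringB.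
- move=> h; right; split=> //.
  have -> : (1 - x)^-1 = 1 + x / (1 - x) by field.
  exact: subringD.
- move=> h; left; split=> //.
  have -> : x^-1 = 1 + (x / (1 - x))^-1 by field; rewrite x1 x0.
  exact: subringD.
Qed.

End Subrings.

(** * Primitive polynomials and Nagata rings *)

Section Polynomials.
Context {K : fieldType}.
Implicit Types (A B I J M S V : set K) (x y : K) (f g p q : {poly K}).

Definition coefs_in A p := forall i, A p`_i.

Lemma polyOver_coefs_in A p : A 0 -> p \is a polyOver [in A] <-> coefs_in A p.
Proof.
move=> A0; split=> [/allP h i|h].
  have [lt_ip|le_pi] := ltnP i (size p); last by rewrite nth_default.
  by have := h _ (mem_nth 0 lt_ip); rewrite inE.
by apply/allP => c /(nthP 0)[i _ <-]; rewrite inE; apply: h.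
Qed.

Lemma coefs_inS A B p : A `<=` B -> coefs_in A p -> coefs_in B p.
Proof. by move=> AB h i; apply: AB. Qed.

Lemma coefs_inC A c : A 0 -> A c -> coefs_in A c%:P.
Proof. by move=> A0 Ac i; rewrite coefC; case: ifP. Qed.

Lemma coefs_inX A : subring A -> coefs_in A 'X.
Proof.
by move=> hA i; rewrite coefX; case: eqP => _; [apply: subring1|apply: subring0].
Qed.

Lemma coefs_inB A p q :
  subring A -> coefs_in A p -> coefs_in A q -> coefs_in A (p - q).
Proof. by move=> hA hp hq i; rewrite coefB; apply: subringB. Qed.

Lemma coefs_inM A p q :
  subring A -> coefs_in A p -> coefs_in A q -> coefs_in A (p * q).
Proof.
by move=> hA hp hq i; rewrite coefM; apply: subring_sum => // j _; apply: subringM.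
Qed.

Lemma coefs_inMl A I p q :
  ideal A I -> coefs_in A p -> coefs_in I q -> coefs_in I (p * q).
Proof.
by move=> hI hp hq i; rewrite coefM; apply: (ideal_sum hI) => j _; case: hI => _ _ _; apply.
Qed.

Lemma coefs_inMr A I p q :
  ideal A I -> coefs_in I p -> coefs_in A q -> coefs_in I (p * q).
Proof. by move=> hI hp hq; rewrite mulrC; apply: coefs_inMl hI hq hp. Qed.

Lemma coefs_inZ A c p : subring A -> A c -> coefs_in A p -> coefs_in A (c *: p).
Proof. by move=> hA Ac hp i; rewrite coefZ; apply: subringM. Qed.

(** Over a local ring this amounts to [content A g = A] ([content_unit], [content_prim]), and in
    this form it visibly passes to larger rings. *)
Definition prim A g := coefs_in A g /\ exists i, ring_unit A g`_i.

Lemma primS A B g : A `<=` B -> prim A g -> prim B g.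
Proof.
by move=> AB [hg [i ui]]; split; [apply: coefs_inS hg|exists i; apply: ring_unitS ui].
Qed.

Lemma prim_neq0 A g : prim A g -> g != 0.
Proof. by move=> [_ [i [+ _]]]; apply: contraNneq => ->; rewrite coef0. Qed.

Lemma not_prim A g : coefs_in A g -> ~ prim A g -> coefs_in (nonunits A) g.
Proof. by move=> hg np i; split=> // ui; apply: np; split=> //; exists i. Qed.

Lemma nonunits_not_prim A g : coefs_in (nonunits A) g -> ~ prim A g.
Proof. by move=> hn [_ [i ui]]; case: (hn i). Qed.

Lemma ring_unitD A u x :
  localr A -> A u -> ring_unit A u -> nonunits A x -> ring_unit A (u + x).
Proof.
move=> lA; have hN := nonunits_ideal lA; case: (lA) => hA _.
move=> Au uu Nx; apply: contrapT => nu.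
suff: nonunits A u by case.
rewrite -(addrK x u); apply: (idealB hA hN _ Nx); split=> //.
by apply: subringD => //; case: Nx.
Qed.

Lemma prim_low A g : prim A g ->
  exists2 i, ring_unit A g`_i & forall j, (j < i)%N -> nonunits A g`_j.
Proof.
move=> [hg [i ui]].
have ex : exists i, `[< ring_unit A g`_i >] by exists i; apply/asboolP.
case: (ex_minnP ex) => m /asboolP um mmin; exists m => // j lt_jm.
by split=> // uj; move: (mmin j); rewrite leqNgt lt_jm => h; suff: false by []; apply/h/asboolP.
Qed.

(* Gauss: over the residue field, a product of nonzero polynomials is nonzero. *)
Lemma primM A f g : localr A -> prim A f -> prim A g -> prim A (f * g).
Proof.
move=> lA pf pg; have hN := nonunits_ideal lA; case: (lA) => hA _.
have [i ui lowi] := prim_low pf; have [j uj lowj] := prim_low pg.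
have [hf _] := pf; have [hg _] := pg.
split; first exact: coefs_inM.
have lti : (i < (i + j).+1)%N by rewrite ltnS leq_addr.
exists (i + j)%N; rewrite coefM (bigD1 (Ordinal lti)) //= addKn.
apply: ring_unitD => //; [exact: subringM|exact: ring_unitM|].
apply: (ideal_sum hN) => k; case: (hN) => _ _ _ NM.
rewrite -val_eqE /= neq_ltn => /orP[lt_ki|lt_ik].
  by rewrite mulrC; apply: NM => //; apply: lowi.
by apply: NM => //; apply: lowj; rewrite ltn_subLR ?ltn_add2r // -ltnS.
Qed.

Lemma prim_mull A f g :
  localr A -> coefs_in A f -> coefs_in A g -> prim A (f * g) -> prim A f.
Proof.
move=> lA hf hg pfg; apply: contrapT => /(not_prim hf) nf.
by apply: nonunits_not_prim pfg; apply: coefs_inMr (nonunits_ideal lA) nf hg.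
Qed.

(** The [f j] are only known to lie in [K]. They solve a linear system whose matrix is the identity
    modulo the maximal ideal of [A], hence invertible over [A]. The proof eliminates the last
    unknown, whose pivot [1 - c N] is a unit. *)
Lemma nakayama A (N : nat) (f : nat -> K) :
  localr A ->
  (forall j, (j < N)%N -> exists a (c : nat -> K),
     [/\ A a, forall i, nonunits A (c i) & f j = a + \sum_(i < N) c i * f i]) ->
  forall j, (j < N)%N -> A (f j).
Proof.
move=> lA; have hN := nonunits_ideal lA; case: (lA) => hA _.
have [NA N0 ND NM] := hN.
elim: N => // N IH hf.
have [a [c [Aa Nc ef]]] := hf N (ltnSn N).
move: ef; rewrite big_ord_recr /= => ef.
have [u0 Au] : ring_unit A (1 - c N) by apply: local_ring_unit1B.
set u := (1 - c N)^-1 in Au.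
have efN : f N = u * a + \sum_(i < N) (u * c i) * f i.
  under eq_bigr => i _ do rewrite -mulrA.
  rewrite -mulr_sumr -mulrDr; apply: (mulfI u0); rewrite mulrA mulfV // mul1r.
  by rewrite mulrBl mul1r {1}ef; ring.
have fA : forall j, (j < N)%N -> A (f j).
  apply: IH => j lt_jN.
  have [b [d [Ab Nd ej]]] := hf j (ltnW lt_jN : (j < N.+1)%N).
  exists (b + d N * (u * a)), (fun i => d i + d N * (u * c i)).
  have NAu x : nonunits A x -> nonunits A (u * x) by apply: NM.
  split.
  - by apply: subringD => //; apply: subringM; [|exact: NA|exact: subringM].
  - by move=> i; apply: ND => //; apply: NM; [exact: NA|apply: NAu].
  - rewrite {1}ej big_ord_recr /= efN.
    under [in RHS]eq_bigr => i _ do rewrite mulrDl -mulrA.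
    by rewrite big_split /= -mulr_sumr; ring.
move=> j; rewrite ltnS leq_eqVlt => /predU1P[->|]; last exact: fA.
rewrite efN; apply: subringD; [by []|exact: subringM|].
apply: subring_sum => // i _; apply: subringM; [by []| |exact: fA].
by apply: NA; apply: NM.
Qed.

(** Let [k] be the first index at which [g] has a unit coefficient. In the coefficient [j + k] of
    [f * g], the terms f_i with i > j carry nonunit coefficients of [g], and those with i < j are
    known by induction. So every f_j lies in [A] plus nonunit multiples of the f_i, and [nakayama]
    applies. *)
Lemma prim_cancel A f g :
  localr A -> prim A g -> coefs_in A (f * g) -> coefs_in A f.
Proof.
move=> lA pg hfg; have hN := nonunits_ideal lA; case: (lA) => hA _.
have [NA N0 ND NM] := hN.
have [hg _] := pg; have [k [uk0 uk] lowk] := prim_low pg.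
(* [C] is the [A]-module A + m f_0 + m f_1 + ..., where m consists of the nonunits of [A]. *)
pose C y := exists a (c : nat -> K),
  [/\ A a, forall i, nonunits A (c i) & y = a + \sum_(i < size f) c i * f`_i].
have CA a : A a -> C a.
  move=> Aa; exists a, (fun=> 0); split=> //.
  by rewrite big1 ?addr0 // => i _; rewrite mul0r.
have CD y z : C y -> C z -> C (y + z).
  move=> [a [c [Aa Nc ->]]] [b [d [Ab Nd ->]]].
  exists (a + b), (fun i => c i + d i); split; [exact: subringD|by move=> i; apply: ND|].
  by rewrite addrACA -big_split; congr (_ + _); apply: eq_bigr => i _; rewrite mulrDl.
have CM b y : A b -> C y -> C (b * y).
  move=> Ab [a [c [Aa Nc ->]]].
  exists (b * a), (fun i => b * c i); split; [exact: subringM|by move=> i; apply: NM|].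
  by rewrite mulrDr mulr_sumr; congr (_ + _); apply: eq_bigr => i _; rewrite mulrA.
have CN b l : nonunits A b -> C (b * f`_l).
  move=> Nb; have [lt_l|le_l] := ltnP l (size f); last first.
    by rewrite nth_default // mulr0; apply/CA/subring0.
  exists 0, (fun i => if i == l then b else 0); split; [exact: subring0|by move=> i; case: ifP|].
  rewrite add0r (bigD1 (Ordinal lt_l)) //= eqxx big1 ?addr0 // => i.
  by rewrite -val_eqE /= => /negPf ->; rewrite mul0r.
have Csum (T : Type) (r : seq T) (P : pred T) (F : T -> K) :
    (forall i, P i -> C (F i)) -> C (\sum_(i <- r | P i) F i).
  by move=> hF; elim/big_ind: _ => //; apply/CA/subring0.
have fC j : C f`_j.
  elim/ltn_ind: j => j IH.
  have lt_k : (j < (j + k).+1)%N by rewrite ltnS leq_addr.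
  have := hfg (j + k)%N; rewrite coefM (bigD1 (Ordinal lt_k)) //= addKn => hjk.
  have -> : f`_j = (g`_k)^-1 * (f`_j * g`_k) by rewrite mulrCA mulVf ?mulr1.
  apply: (CM) => //.
  rewrite -[_ * _](addrK (\sum_(i < (j + k).+1 | i != Ordinal lt_k)
    f`_i * g`_(j + k - i)%N)).
  apply: CD; first exact: CA.
  rewrite -mulN1r; apply: (CM); first by apply/subringN/subring1.
  apply: Csum => i; rewrite -val_eqE /= neq_ltn => /orP[lt_ij|lt_ji].
    by rewrite mulrC; apply: CM => //; apply: IH.
  by rewrite mulrC; apply/CN/lowk; rewrite ltn_subLR ?ltn_add2r // -ltnS.
move=> j; have [lt_j|le_j] := ltnP j (size f); last first.
  by rewrite nth_default //; apply: subring0.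
by apply: (nakayama (f := fun i => f`_i) lA) lt_j => i _; apply: fC.
Qed.

End Polynomials.

Local Notation "f :/: g" := (tofrac f / tofrac g) (at level 40, left associativity).

Lemma subf_div (F : fieldType) (x y z t : F) :
  y != 0 -> t != 0 -> x / y - z / t = (x * t - z * y) / (y * t).
Proof. by move=> y0 t0; rewrite -mulNr addf_div // mulNr. Qed.

Section Nagata.
Context {K : fieldType}.
Implicit Types (A B V : set K) (f g p q : {poly K}).

Lemma content_unit A g : subring A -> prim A g -> content A g = A.
Proof.
move=> hA [hg [i [gi0 Agi]]].
have SA : [set c | c \in (g : seq K)] `<=` A.
  by move=> _ /(nthP 0)[j _ <-]; apply: hg.
have hI := ideal_gen_ideal hA SA.
apply: (ideal_full hI); rewrite -(mulVf gi0).
case: (hI) => _ _ _; apply=> //; apply: sub_ideal_gen => /=.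
by apply: mem_nth; rewrite ltnNge; apply: contra_neqN gi0; apply: nth_default.
Qed.

Lemma content_prim A g :
  localr A -> coefs_in A g -> content A g = A -> prim A g.
Proof.
move=> lA hg cg; apply: contrapT => /(not_prim hg) ng.
case: (lA) => hA _; apply: (nonunits1 hA).
have : content A g 1 by rewrite cg; apply: subring1.
by apply: (ideal_gen_min (nonunits_ideal lA)) => _ /(nthP 0)[j _ <-]; apply: ng.
Qed.

Lemma nagata_div A f g : subring A -> coefs_in A f -> prim A g -> nagata A (f :/: g).
Proof.
move=> hA hf pg; exists f, g; have A0 := subring0 hA.
by split; rewrite ?(polyOver_coefs_in _ A0) //; [case: pg|apply: content_unit].
Qed.

Lemma nagataP A h : localr A ->
  nagata A h <-> exists f g, [/\ coefs_in A f, prim A g & h = f :/: g].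
Proof.
move=> lA; case: (lA) => hA _; have A0 := subring0 hA.
split=> [[f [g [/(polyOver_coefs_in _ A0) hf /(polyOver_coefs_in _ A0) hg cg ->]]]|].
  by exists f, g; split=> //; apply: content_prim.
by case=> f [g [hf pg ->]]; apply: nagata_div.
Qed.

Lemma frac_neq0 A g : prim A g -> tofrac g != 0.
Proof. by move=> /prim_neq0; rewrite tofrac_eq0. Qed.

Lemma fracK f g f' g' : g != 0 -> g' != 0 -> f :/: g = f' :/: g' -> f * g' = f' * g.
Proof.
rewrite -!(tofrac_eq0 (R := {poly K})) => g0 g'0 /eqP.
by rewrite (eqr_div _ _ g0 g'0) -!tofracM tofrac_eq => /eqP.
Qed.

Lemma subring_nagata A : localr A -> subring (nagata A).
Proof.
move=> lA; case: (lA) => hA _; apply/subringP; split.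
- rewrite -(divr1 1) -tofrac1; apply: nagata_div => //.
    by apply: coefs_inC; [apply: subring0|apply: subring1].
  split; first by apply: coefs_inC; [apply: subring0|apply: subring1].
  by exists 0; rewrite coefC; apply: ring_unit1.
- move=> _ _ /(nagataP _ lA)[f [g [hf pg ->]]] /(nagataP _ lA)[f' [g' [hf' pg' ->]]].
  have g0 := frac_neq0 pg; have g'0 := frac_neq0 pg'.
  have -> : f :/: g - f' :/: g' = (f * g' - f' * g) :/: (g * g').
    by rewrite tofracB !tofracM (subf_div _ _ g0 g'0).
  apply: nagata_div; [by []| |exact: primM].
  by apply: coefs_inB => //; apply: coefs_inM => //; [case: pg'|case: pg].
- move=> _ _ /(nagataP _ lA)[f [g [hf pg ->]]] /(nagataP _ lA)[f' [g' [hf' pg' ->]]].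
  have -> : f :/: g * (f' :/: g') = (f * f') :/: (g * g').
    by rewrite !tofracM invfM mulrACA.
  by apply: nagata_div; [by []|apply: coefs_inM|apply: primM].
Qed.

Lemma nagata_inv A f g : subring A -> prim A f -> prim A g ->
  ring_unit (nagata A) (f :/: g).
Proof.
move=> hA pf pg; split.
  by apply: mulf_neq0; [exact: frac_neq0 pf|apply: invr_neq0; exact: frac_neq0 pg].
by rewrite invf_div; apply: nagata_div => //; case: pg.
Qed.

Lemma nagata_inv_prim A f g : localr A -> coefs_in A f -> prim A g ->
  ring_unit (nagata A) (f :/: g) -> prim A f.
Proof.
move=> lA hf pg [u0 /(nagataP _ lA)[f' [g' [hf' pg' e]]]].
have f0 : f != 0 by apply: contraNneq u0 => ->; rewrite tofrac0 mul0r.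
apply: (prim_mull lA hf hf').
suff -> : f * f' = g * g' by apply: primM.
by rewrite invf_div in e; rewrite (fracK f0 (prim_neq0 pg') e) mulrC.
Qed.

Lemma localr_nagata A : localr A -> localr (nagata A).
Proof.
move=> lA; case: (lA) => hA _; split; first exact: subring_nagata.
move=> _ /(nagataP _ lA)[f [g [hf pg ->]]].
have [pf|npf] := pselect (prim A f); first by left; apply: nagata_inv.
right; have g0 := frac_neq0 pg.
have -> : 1 - f :/: g = (g - f) :/: g by rewrite tofracB mulrBl (divff g0).
have [hg [i ui]] := pg.
apply: nagata_inv => //; split; first exact: coefs_inB.
exists i; rewrite coefB; apply: ring_unitD => //.
rewrite -mulN1r; case: (nonunits_ideal lA) => _ _ _; apply.
  by apply/subringN/subring1.
exact: not_prim.
Qed.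

Lemma nagataS A B : localr A -> subring B -> A `<=` B -> nagata A `<=` nagata B.
Proof.
move=> lA hB AB _ /(nagataP _ lA)[f [g [hf pg ->]]].
by apply: nagata_div => //; [apply: coefs_inS hf|apply: primS pg].
Qed.

Lemma prim_polyC A c : subring A -> A c -> ring_unit A c -> prim A c%:P.
Proof.
by move=> hA Ac uc; split; [apply: coefs_inC => //; apply: subring0|exists 0%N; rewrite coefC].
Qed.

Lemma prim1 A : subring A -> prim A 1.
Proof.
by move=> hA; apply: (@prim_polyC A 1) => //; [apply: subring1|apply: ring_unit1].
Qed.

Lemma nagata_tofrac A f : subring A -> coefs_in A f -> nagata A (tofrac f).
Proof.
move=> hA hf; rewrite -[tofrac f]divr1 -tofrac1; apply: nagata_div => //.
exact: prim1.
Qed.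

(** In [f * g' = f' * g] the primitive [g'] is removed by [prim_cancel]. Since no condition ties [g]
    to one ring, the same denominator can serve many rings at once. *)
Lemma nagata_num A f g :
  localr A -> coefs_in A g -> nagata A (f :/: g) -> g != 0 -> coefs_in A f.
Proof.
move=> lA hg /(nagataP _ lA)[f' [g' [hf' pg' e]]] g0; case: (lA) => hA _.
apply: (prim_cancel lA pg').
by rewrite (fracK g0 (prim_neq0 pg') e); apply: coefs_inM.
Qed.

Lemma localr_nonunits_nagataP A f g :
  localr A -> coefs_in A f -> prim A g ->
  nonunits (nagata A) (f :/: g) <-> coefs_in (nonunits A) f.
Proof.
move=> lA hf pg; case: (lA) => hA _; split=> [[_ nu]|nf].
  by apply: not_prim => // pf; apply: nu; apply: nagata_inv.
split; first exact: nagata_div.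
by move=> /(nagata_inv_prim lA hf pg); apply: nonunits_not_prim.
Qed.

End Nagata.

(** * Valuation rings and integrality *)

Section Valuations.
Context {K : fieldType}.
Implicit Types (A B I J M S V W : set K) (x y : K) (f g p q : {poly K}).

(** [valuation_ring] compares elements of the quotient field of [V] only; here that quotient field
    is all of [K]. *)
Definition valuation V := subring V /\ forall x, V x \/ V x^-1.

Lemma valuation_valuation_ring V : valuation V -> valuation_ring V.
Proof. by move=> [hV hv]; split. Qed.

Lemma valuation_localr V : valuation V -> localr V.
Proof. by move=> /valuation_valuation_ring/valuation_ring_localr. Qed.

Lemma horner_rev n p x : (size p <= n.+1)%N -> x != 0 ->
  (\poly_(i < n.+1) p`_(n - i)%N).[x] = x ^+ n * p.[x^-1].
Proof.
move=> sp x0; rewrite horner_poly (horner_coef_wide _ sp) mulr_sumr.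
rewrite (reindex_inj rev_ord_inj) /=; apply: eq_bigr => i _.
have le_in : (i <= n)%N by rewrite -ltnS.
rewrite subSS subKn // mulrCA; congr (_ * _).
by rewrite exprVn; apply: (mulIf (expf_neq0 i x0)); rewrite -exprD subnK // divfK // expf_neq0.
Qed.

Definition adjoin A x := [set y | exists2 p, coefs_in A p & y = p.[x]].

Lemma subring_adjoin A x : subring A -> subring (adjoin A x).
Proof.
move=> hA; apply/subringP; split.
- exists 1; rewrite ?hornerC //.
  by apply: (@coefs_inC _ _ 1); [apply: subring0|apply: subring1].
- move=> _ _ [p hp ->] [q hq ->]; exists (p - q); first exact: coefs_inB.
  by rewrite hornerD hornerN.
- move=> _ _ [p hp ->] [q hq ->]; exists (p * q); first exact: coefs_inM.
  by rewrite hornerM.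
Qed.

Lemma sub_adjoin A x : subring A -> A `<=` adjoin A x.
Proof.
by move=> hA a Aa; exists a%:P; rewrite ?hornerC //; apply: coefs_inC => //; apply: subring0.
Qed.

Lemma adjoin_gen A x : subring A -> adjoin A x x.
Proof. by move=> hA; exists 'X; rewrite ?hornerX //; apply: coefs_inX. Qed.

Lemma adjoin_ideal A J x :
  subring A -> ideal A J ->
  ideal (adjoin A x) [set y | exists2 p, coefs_in J p & y = p.[x]].
Proof.
move=> hA hJ; have [JA J0 JD JM] := hJ; split.
- by move=> _ [p hp ->]; exists p => //; apply: coefs_inS hp.
- by exists 0; rewrite ?horner0 // => i; rewrite coef0.
- move=> _ _ [p hp ->] [q hq ->]; exists (p + q); rewrite ?hornerD // => i.
  by rewrite coefD; apply: JD.
- move=> _ _ [p hp ->] [q hq ->]; exists (p * q); rewrite ?hornerM //.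
  exact: coefs_inMl hJ hp hq.
Qed.

(* The relation for [q] makes [x ^+ m], [m] the degree of [q], a combination of
   lower powers of [x] with coefficients in [J]; substitute it in the leading
   term of [p]. *)
Lemma adjoin_descent A J x :
  subring A -> ideal A J -> (forall j, J j -> ring_unit A (1 - j)) -> x != 0 ->
  forall p q, coefs_in J p -> coefs_in J q -> p.[x] = 1 -> q.[x^-1] = 1 ->
    (size q <= size p)%N ->
  exists p', [/\ coefs_in J p', p'.[x] = 1 & (size p' < size p)%N].
Proof.
move=> hA hJ uJ x0 p q hp hq px qx le_qp; have [JA J0 JD JM] := hJ.
have q0 : q != 0 by apply: contra_eq_neq qx => ->; rewrite horner0 eq_sym oner_eq0.
have p0 : p != 0 by apply: contra_eq_neq px => ->; rewrite horner0 eq_sym oner_eq0.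
set m := (size q).-1; have sq : size q = m.+1 by rewrite prednK // size_poly_gt0.
set n := (size p).-1; have sp : size p = n.+1 by rewrite prednK // size_poly_gt0.
have le_mn : (m <= n)%N by move: le_qp; rewrite sq sp.
have [u0 Au] := uJ _ (hq 0%N); set u := (1 - q`_0)^-1 in Au.
pose r := \poly_(i < m) (u * q`_(m - i)%N).
have Jr : coefs_in J r by move=> i; rewrite coef_poly; case: ifP => // _; apply: JM.
have rx : r.[x] = x ^+ m.
  have := @horner_rev m q x; rewrite sq => /(_ (leqnn _) x0).
  rewrite qx mulr1 horner_poly big_ord_recr /= subnn => e.
  rewrite horner_poly; under eq_bigr => i _ do rewrite -mulrA.
  rewrite -mulr_sumr; apply: (mulfI u0); rewrite mulrA mulfV // mul1r.
  by rewrite mulrBl mul1r -{1}e addrK.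
exists (p - lead_coef p *: 'X^(n - m) * ('X^m - r)); split.
- have Jl : J (lead_coef p) by apply: hp.
  move=> i; rewrite coefB; apply: (idealB hA hJ) => //.
  rewrite -scalerAl coefZ mulrC; apply: JM => //.
  rewrite mulrBr -exprD coefB coefXn; apply: subringB => //.
    by case: eqP => _; [apply: subring1|apply: subring0].
  by rewrite coefXnM; case: ifP => // _; [apply: subring0|apply: JA].
- by rewrite hornerD hornerN hornerM hornerD hornerN hornerXn rx subrr mulr0 subr0.
- rewrite sp ltnS; apply/leq_sizeP => j le_nj; rewrite coefB -scalerAl coefZ.
  rewrite mulrBr -exprD subnK // coefB coefXn coefXnM lead_coefE -/n.
  move: le_nj; rewrite leq_eqVlt => /predU1P[<-|lt_nj].
    rewrite eqxx ltnNge leq_subr /= subKn //.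
    by rewrite [r`_m]nth_default ?size_poly // subr0 mulr1 subrr.
  rewrite (gtn_eqF lt_nj) nth_default ?sp // !sub0r ltnNge.
  have le_nmj : (n - m <= j)%N by rewrite (leq_trans (leq_subr _ _) (ltnW lt_nj)).
  rewrite le_nmj /= [r`_ _]nth_default ?oppr0 ?mulr0 ?oppr0 //.
  by apply: leq_trans (size_poly _ _) _; rewrite leq_subRL // subnK // ltnW.
Qed.

(** The longer of two such relations can be shortened by the other, and exchanging [x] with [x^-1]
    exchanges their roles, so their total length would descend forever. Hence [J] cannot generate
    the unit ideal both in A[x] and in A[1/x], the heart of Chevalley's theorem. *)
Lemma adjoin_proper A J x :
  subring A -> ideal A J -> (forall j, J j -> ring_unit A (1 - j)) -> x != 0 ->
  forall p q, coefs_in J p -> coefs_in J q -> p.[x] = 1 -> q.[x^-1] = 1 -> False.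
Proof.
move=> hA hJ uJ x0 p q.
have [N] := ubnP (size p + size q); elim: N => // N IH in x x0 p q *.
rewrite ltnS => leN hp hq px qx.
wlog le_qp : x x0 p q leN hp hq px qx / (size q <= size p)%N.
  move=> h; case: (leqP (size q) (size p)) => [|/ltnW]; first exact: (h x).
  by apply: (h x^-1); rewrite ?invr_eq0 ?invrK // addnC.
have [p' [hp' px' lt_p]] := adjoin_descent hA hJ uJ x0 hp hq px qx le_qp.
apply: (IH x x0 p' q) => //.
by apply: leq_trans leN; rewrite ltn_add2r.
Qed.

(** [V] is maximal among the rings above [A] in which [S] still generates a proper ideal. By
    maximality an [x] outside [V] makes this ideal improper in V[x], and [adjoin_proper] forbids
    that for both [x] and [x^-1]. *)
Lemma chevalley A S : subring A -> S `<=` A -> ~ ideal_gen A S 1 ->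
  exists V, [/\ valuation V, A `<=` V & S `<=` nonunits V].
Proof.
move=> hA SA S1.
have [] := @Zorn_above _ (fun B => [/\ subring B, S `<=` B & ~ ideal_gen B S 1]) A.
- by [].
- move=> F F0 hF Ft.
  have hU : subring (\bigcup_(X in F) X) by apply: subring_bigcup => // B /hF[[]].
  case: (F0) => B0 FB0; have SB0 : S `<=` B0 by case: (hF _ FB0) => -[].
  split=> //; first by move=> x Sx; exists B0 => //; apply: SB0.
  suff hI : ideal (\bigcup_(X in F) X) (\bigcup_(X in F) ideal_gen X S).
    move=> /(ideal_gen_min hI)[|B FB]; last by case: (hF _ FB) => -[].
    by move=> x Sx; exists B0 => //; apply: sub_ideal_gen.
  have gI B : F B -> ideal B (ideal_gen B S).
    by move=> /hF[[hB SB _] _]; apply: ideal_gen_ideal.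
  have mono B C : F B -> F C -> B `<=` C -> ideal_gen B S `<=` ideal_gen C S.
    move=> FB FC BC x hx; have [CC C0 CD CM] := gI _ FC; have [BB _ _ _] := gI _ FB.
    suff [] : (B `&` ideal_gen C S) x by [].
    apply: (ideal_gen_min _ _ hx); last first.
      by move=> y Sy; split; [case: (hF _ FB) => -[_ + _] _; apply|apply: sub_ideal_gen].
    have [[hB _ _] _] := hF _ FB; split.
    + by move=> y [].
    + by split=> //; apply: subring0.
    + by move=> y z [By Cy] [Bz Cz]; split; [apply: subringD|apply: CD].
    + by move=> a y Ba [By Cy]; split; [apply: subringM|apply: CM => //; apply: BC].
  split.
  + by move=> x [B FB Bx]; exists B => //; case: (gI _ FB) => + _ _ _; apply.
  + by exists B0 => //; case: (gI _ FB0).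
  + move=> x y [B FB Bx] [C FC Cy]; case: (Ft _ _ FB FC) => h.
      by exists C => //; case: (gI _ FC) => _ _ + _; apply=> //; apply: (mono B).
    by exists B => //; case: (gI _ FB) => _ _ + _; apply=> //; apply: (mono C).
  + move=> a x [B FB Ba] [C FC Cx]; case: (Ft _ _ FB FC) => h.
      by exists C => //; case: (gI _ FC) => _ _ _; apply=> //; apply: h.
    by exists B => //; case: (gI _ FB) => _ _ _; apply=> //; apply: (mono C).
move=> V [[hV SV V1] AV Vmax].
have hJ := ideal_gen_ideal hV SV; set J := ideal_gen V S in V1 hJ.
have [JV J0 JD JM] := hJ.
have adj x : ~ V x -> exists2 p, coefs_in J p & p.[x] = 1.
  move=> nVx; have hVx := subring_adjoin x hV; have VVx := sub_adjoin x hV.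
  have : ideal_gen (adjoin V x) S 1.
    apply: contrapT => h; apply: (Vmax (adjoin V x)).
      by split=> // VxV; apply: nVx; apply: VxV; apply: adjoin_gen.
    by split=> //; apply: subset_trans VVx.
  move=> /(ideal_gen_min (adjoin_ideal x hV hJ))[|p hp ->]; last by exists p.
  move=> y Sy; exists y%:P; rewrite ?hornerC //; apply: coefs_inC => //.
  exact: sub_ideal_gen.
(* If the inverse u of [1 - j] were outside [V], it would satisfy p(u) = 1 with [p] over [J];
   clearing denominators puts a power of [1 - j] in [J]. This power is 1 modulo [J], so 1 would lie
   in [J]. *)
have uJ j : J j -> ring_unit V (1 - j).
  move=> Jj; have j1 : 1 - j != 0.
    by apply/eqP => e; apply: V1; rewrite -(subr0 1) -e opprB addrC subrK.
  split=> //; apply: contrapT => /adj[p hp pu]; apply: V1.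
  have sp : (size p <= (size p).-1.+1)%N by apply: leqSpred.
  have := horner_rev sp j1; rewrite pu mulr1; set n := (size p).-1 => e.
  have J1j : J ((1 - j) ^+ n).
    rewrite -e horner_poly; apply: (ideal_sum hJ) => i _.
    rewrite mulrC; apply: JM => //; apply: subringX => //.
    by apply: subringB; [|exact: subring1|exact: JV].
  by have := JD _ _ (ideal_1B_expr n hV hJ Jj) J1j; rewrite subrK.
exists V; split=> //.
- split=> // x; apply: contrapT => /not_orP[nx nx'].
  have x0 : x != 0 by apply/eqP => x0; apply: nx; rewrite x0; apply: subring0.
  have [p hp px] := adj _ nx; have [q hq qx] := adj _ nx'.
  exact: (adjoin_proper hV hJ uJ x0 hp hq px qx).
- move=> x Sx; split; first exact: SV.
  by move=> [x0 Vx]; apply: V1; rewrite -(mulVf x0); apply: JM => //; apply: sub_ideal_gen.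
Qed.

(** If [x] is not in [V], then [x^-1] is, and dividing the monic equation by a power of [x] writes
    [x] as a polynomial in [x^-1] over [A]. *)
Lemma integral_valuation A V x :
  valuation V -> A 0 -> A `<=` V -> integral_over A x -> V x.
Proof.
move=> [hV hv] A0 AV [p [mp /(polyOver_coefs_in _ A0) hp /rootP px]].
case: (hv x) => [//|Vx'].
have [->|x0] := eqVneq x 0; first exact: subring0.
have p0 : p != 0 by apply: monic_neq0.
have [s|[n s]] : size p = 1%N \/ exists n, size p = n.+2.
- have : size p != 0%N by rewrite size_poly_eq0.
  by case: (size p) => [//|[|n]] _; [left|right; exists n].
- have p1 : p = 1.
    by have := monicP mp; rewrite (size1_polyC (eq_leq s)) lead_coefC => ->.
  by move: px; rewrite p1 hornerC => /eqP; rewrite oner_eq0.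
have := @horner_rev n.+1 p x^-1; rewrite s leqnn invrK px invr_eq0 => /(_ isT x0).
rewrite mulr0 horner_poly big_ord_recl /= subn0 expr0 mulr1.
have -> : p`_n.+1 = 1 by have := monicP mp; rewrite lead_coefE s.
move=> e.
have -> : x = - \sum_(i < n.+1) p`_(n - i) * x^-1 ^+ i.
  apply: (mulfI (x := x^-1)); first by rewrite invr_eq0.
  move/eqP: e; rewrite addr_eq0 mulVf // mulrN mulr_sumr => /eqP ->.
  congr (- _); apply: eq_bigr => i _.
  by rewrite /bump add1n subSS exprS mulrCA.
apply: subringN => //; apply: subring_sum => // i _; apply: subringM => //.
  by apply: AV.
exact: subringX.
Qed.

(* If [1] lay in the ideal of [A[1/x]] generated by [J] and [1/x], multiplying
   by a power of [x] would give an equation of integral dependence for [x]. *)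
Lemma not_integral_valuation A J x :
  subring A -> ideal A J -> (forall j, J j -> ring_unit A (1 - j)) ->
  ~ integral_over A x ->
  exists V, [/\ valuation V, A `<=` V, J `<=` nonunits V & ~ V x].
Proof.
move=> hA hJ uJ nx; have [JA J0 JD JM] := hJ.
have A0 := subring0 hA.
have x0 : x != 0.
  apply/eqP => x0; apply: nx; exists 'X; split; first exact: monicX.
    by apply/polyOver_coefs_in => //; apply: coefs_inX.
  by rewrite x0 /root hornerX.
pose y := x^-1; have hAy := subring_adjoin y hA.
have SA : J `|` [set y] `<=` adjoin A y.
  by move=> _ [/JA/(sub_adjoin y hA)|->] //; apply: adjoin_gen.
have [|V [vV AV JV]] := chevalley hAy SA.
  suff hI : ideal (adjoin A y) [set z | exists p, [/\ coefs_in A p, J p`_0 & z = p.[y]]].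
    move=> /(ideal_gen_min hI)[|p [hp Jp0 py]].
      move=> z [Jz|->].
        exists z%:P; rewrite coefC hornerC; split=> //.
        by apply: coefs_inC => //; apply: JA.
      by exists 'X; rewrite coefX hornerX; split=> //; apply: coefs_inX.
    apply: nx; have [u0 Au] := uJ _ Jp0; set u := (1 - p`_0)^-1 in Au.
    (* The formal degree [size p] bounds the degree of [1 - p] without a case distinction on [p].
       The reversal of [1 - p] has leading coefficient 1 - p_0, which [u] turns into 1. *)
    pose n := size p; have sr : (size (1 - p)%R <= n.+1)%N.
      rewrite (leq_trans (size_polyD _ _)) // size_polyN size_poly1 geq_max.
      by rewrite leqnSn andbT.
    have := horner_rev sr x0; rewrite hornerD hornerN hornerC -py subrr mulr0 => e.
    have er : (\poly_(i < n.+1) (u * (1 - p)`_(n - i)%N)) =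
              u *: \poly_(i < n.+1) (1 - p)`_(n - i)%N.
      by apply/polyP => i; rewrite coefZ !coef_poly; case: ifP; rewrite ?mulr0.
    have un : u * (1 - p)`_(n - n)%N = 1 by rewrite subnn coefB coefC mulVf.
    exists (\poly_(i < n.+1) (u * (1 - p)`_(n - i)%N)); split.
    - by rewrite monicE lead_coef_poly ?un // oner_eq0.
    - apply/polyOver_coefs_in => // i; rewrite coef_poly; case: ifP => // _.
      apply: subringM => //; apply: coefs_inB => //.
      by apply: (@coefs_inC _ _ 1) => //; apply: subring1.
    - by rewrite er /root hornerZ e mulr0.
  split.
  - by move=> _ [p [hp _ ->]]; exists p.
  - by exists 0; rewrite coef0 horner0; split=> // i; rewrite coef0.
  - move=> _ _ [p [hp Jp ->]] [q [hq Jq ->]]; exists (p + q).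
    by rewrite coefD hornerD; split; [move=> i; rewrite coefD; apply: subringD|apply: JD|].
  - move=> _ _ [p hp ->] [q [hq Jq ->]]; exists (p * q).
    by rewrite coef0M hornerM; split; [apply: coefs_inM|apply: JM|].
exists V; split=> //.
- by apply: subset_trans AV; apply: sub_adjoin.
- by move=> z Jz; apply: JV; left.
- by move=> Vx; case: (JV y) => [|_]; [right|apply; rewrite /ring_unit /y invrK invr_eq0].
Qed.

End Valuations.

(** * Fractions and norms of polynomials *)

Lemma fracW (R : idomainType) (h : {fraction R}) :
  exists f g : R, g != 0 /\ h = f :/: g.
Proof.
elim/quotW: h => x; exists (\n_x), (\d_x); split; first exact: denom_ratioP.
have d0 : tofrac \d_x != 0 by rewrite tofrac_eq0 denom_ratioP.
apply: (mulIf d0); rewrite (divfK d0).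
unlock tofrac; rewrite -[LHS]FracField.pi_mul; apply/eqmodP.
rewrite /= FracField.equivfE /FracField.mulf !numden_Ratio ?oner_eq0 ?mulr1 //.
- by rewrite mulrC.
- exact: denom_ratioP.
- exact: denom_ratioP.
Qed.

(** The norm of [g] has coefficients fixed by the Galois group, hence in the base field; [g']
    collects the conjugates of [g] under the nontrivial automorphisms. *)
Lemma norm_poly (F0 : fieldType) (L : splittingFieldType F0) :
  galois 1%AS {:L}%AS -> forall g : {poly L}, g != 0 ->
  exists g', g' != 0 /\ coefs_in [set x | x \in 1%VS] (g * g').
Proof.
move=> gal g g0.
pose G := 'Gal({:L} / 1)%g.
pose N := \prod_(s in G) map_poly (s : gal_of {:L}) g.
have N0 : N != 0.
  by apply/prodf_neq0 => s _; rewrite map_poly_eq0.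
have G1 : (1%g : gal_of {:L}) \in G by apply: group1.
have g1 : map_poly (1%g : gal_of {:L}) g = g.
  by apply/polyP => j; rewrite coef_map /= gal_id.
exists (\prod_(s in G | s != 1%g) map_poly (s : gal_of {:L}) g).
have NE : N = g * \prod_(s in G | s != 1%g) map_poly (s : gal_of {:L}) g.
  by rewrite /N (bigD1 1%g) //= g1.
split; first by move: N0; rewrite NE mulf_eq0 negb_or => /andP[].
rewrite -NE => i /=.
suff: N`_i \in fixedField G by rewrite (galois_fixedField gal).
apply/fixedFieldP; first exact: memvf.
move=> s sG; suff Ns : map_poly s N = N by rewrite -coef_map /= Ns.
rewrite /N rmorph_prod /= [RHS](reindex_inj (mulIg s)) /=.
apply: eq_big => [t|t tG]; first by rewrite groupMr.
by apply/polyP => j; rewrite !coef_map /= galM ?memvf.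
Qed.

(** * Maximal excluding rings, Gauss extensions and integral closure *)

Section MaximalExcluding.
Context {K : fieldType}.
Implicit Types (A B I J V W : set K) (x y : K) (f g : {poly K}).

(* If [a] is a nonunit of a ring [A] maximal without [x], then [x] lies in
   [A[1/a]], so the conductor [(A : x)] contains a power of [a]. *)
Lemma maximal_excluding_localr A x :
  subring A -> ~ A x -> (forall B, subring B -> A `<` B -> B x) -> localr A.
Proof.
move=> hA nAx Amax; split=> // a Aa.
pose I := [set c | A c /\ A (c * x)].
have hI : ideal A I.
  split.
  - by move=> c [].
  - by split; rewrite ?mul0r; apply: subring0.
  - by move=> c d [Ac Acx] [Ad Adx]; split; rewrite ?mulrDl; apply: subringD.
  - by move=> c d Ac [Ad Adx]; split; rewrite -?mulrA; apply: subringM.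
have [IA I0 ID IM] := hI.
have Ipow b : A b -> ~ ring_unit A b -> exists n, I (b ^+ n).
  move=> Ab nb; have [->|b0] := eqVneq b 0; first by exists 1%N; rewrite expr1.
  have nAb : ~ A b^-1 by move=> ?; apply: nb.
  have [p hp xE] : adjoin A b^-1 x.
    apply: Amax; first exact: subring_adjoin.
    split; first exact: sub_adjoin.
    by move=> h; apply/nAb/h/adjoin_gen.
  exists (size p).-1; split; first exact: subringX.
  rewrite xE -horner_rev ?leqSpred // horner_poly.
  apply: subring_sum => // i _; apply: subringM => //.
  exact: subringX.
apply: contrapT => /not_orP[na nb].
have A1a : A (1 - a) by apply: subringB => //; apply: subring1.
have [k Ik] := Ipow _ Aa na; have [l Il] := Ipow _ A1a nb.
(* The conductor contains [a ^+ k] and [(1 - a) ^+ l]. As [1 - a] divides [1 - a ^+ k], it also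
   contains [(1 - a ^+ k) ^+ l], which is 1 modulo [a ^+ k]. *)
apply: nAx; suff [_] : I 1 by rewrite mul1r.
have e : 1 - a ^+ k = (1 - a) * \sum_(i < k) a ^+ i.
  by rewrite -opprB subrX1 -mulNr opprB.
have h1 : I ((1 - a ^+ k) ^+ l).
  rewrite e exprMn mulrC; apply: IM => //.
  by apply: subringX => //; apply: subring_sum => // i _; apply: subringX.
by have := ID _ _ (ideal_1B_expr l hA hI Ik) h1; rewrite subrK.
Qed.

Lemma maximal_excluding_above B x : subring B -> ~ B x ->
  exists A, [/\ subring A, B `<=` A, ~ A x
              & forall C, subring C -> A `<` C -> C x].
Proof.
move=> hB nBx.
have [|F F0 hF Ft|A [[hA nAx] BA Amax]] := @Zorn_above _ (fun A => subring A /\ ~ A x) B.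
- by [].
- split; first by apply: subring_bigcup => // C /hF[[]].
  by case=> C /hF[[_ nCx] _] /nCx.
- exists A; split=> // C hC AC; apply: contrapT => nCx.
  exact: (Amax C).
Qed.

(** Values on [E] are totally ordered, so some coefficient divides all the others. [E] is a separate
    parameter because the lemma serves both valuation rings of the subfield F' and those of the
    ambient field. *)
Lemma scale_prim (E V : set K) g : subring V -> (forall x, E x -> V x \/ V x^-1) ->
  (forall x y, E x -> E y -> E (x / y)) ->
  coefs_in E g -> g != 0 ->
  exists2 i, g`_i != 0 & prim V ((g`_i)^-1 *: g).
Proof.
move=> hV hv Ediv hg g0.
suff [i gi0 Vi] : exists2 i, g`_i != 0 & forall j, (j < size g)%N -> V (g`_j / g`_i).
  exists i => //; split; last first.
    by exists i; rewrite coefZ mulVf //; apply: ring_unit1.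
  move=> j; rewrite coefZ mulrC; have [/Vi//|le_j] := ltnP j (size g).
  by rewrite nth_default // mul0r; apply: subring0.
have [h|//] : (forall j, (j < size g)%N -> g`_j = 0) \/
    exists2 i, g`_i != 0 & forall j, (j < size g)%N -> V (g`_j / g`_i).
  elim: (size g) => [|n [IH|[i gi0 Vi]]]; first by left.
    have [gn|gn] := eqVneq g`_n 0.
      by left=> j; rewrite ltnS leq_eqVlt => /predU1P[->|/IH].
    right; exists n => // j; rewrite ltnS leq_eqVlt => /predU1P[->|/IH->].
      by rewrite divff //; apply: subring1.
    by rewrite mul0r; apply: subring0.
  right; have [h|h] := hv _ (Ediv _ _ (hg n) (hg i)).
    by exists i => // j; rewrite ltnS leq_eqVlt => /predU1P[->|/Vi].
  have [gn|gn] := eqVneq g`_n 0.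
    exists i => // j; rewrite ltnS leq_eqVlt => /predU1P[->|/Vi//].
    by rewrite gn mul0r; apply: subring0.
  exists n => // j; rewrite ltnS leq_eqVlt => /predU1P[->|/Vi Vj].
    by rewrite divff //; apply: subring1.
  have -> : g`_j / g`_n = (g`_j / g`_i) * (g`_n / g`_i)^-1.
    by rewrite invf_div mulrA mulfVK.
  exact: subringM.
case/negP: (g0); rewrite -lead_coef_eq0 lead_coefE; apply/eqP/h.
by rewrite prednK // size_poly_gt0; apply: contraNneq g0 => ->.
Qed.

Lemma divZ c f g : c != 0 -> (c *: f) :/: (c *: g) = f :/: g.
Proof.
move=> c0; rewrite -!mul_polyC !tofracM invfM mulrACA divff ?mul1r //.
by rewrite tofrac_eq0 polyC_eq0.
Qed.

(** [nagata W] is the Gauss extension of [W]: comparing coefficients of least value of [f] and [g]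
    decides which of [f / g] and [g / f] lies in it. *)
Lemma valuation_nagata W : valuation W -> valuation (nagata W).
Proof.
move=> vW; have lW := valuation_localr vW; have [hW hw] := vW.
split; first exact: subring_nagata.
have scale g : g != 0 -> exists2 i, g`_i != 0 & prim W ((g`_i)^-1 *: g).
  by apply: (@scale_prim setT) => //.
have main f g : f != 0 -> g != 0 -> (exists i k, [/\ g`_k != 0, prim W ((f`_i)^-1 *: f),
    prim W ((g`_k)^-1 *: g), f`_i != 0 & W (f`_i / g`_k)]) -> nagata W (f :/: g).
  move=> f0 g0 [i [k [gk0 [hf _] pg fi0 Wik]]].
  rewrite -(@divZ (g`_k)^-1) ?invr_neq0 //; apply: nagata_div => // j.
  rewrite coefZ; have -> : (g`_k)^-1 * f`_j = (f`_i / g`_k) * ((f`_i)^-1 *: f)`_j.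
    by rewrite coefZ mulrACA divff // mul1r.
  exact: subringM.
move=> h; have [f [g [g0 ->]]] := fracW h.
have [->|f0] := eqVneq f 0.
  by left; rewrite tofrac0 mul0r; apply: subring0; apply: subring_nagata.
have [i fi0 pf] := scale _ f0; have [k gk0 pg] := scale _ g0.
have [h1|h1] := hw (f`_i / g`_k); [left|right; rewrite invf_div]; apply: main => //.
  by exists i, k.
by exists k, i; split=> //; rewrite -invf_div.
Qed.

Lemma integral_overP A x : subring A ->
  integral_over A x <-> forall V, valuation V -> A `<=` V -> V x.
Proof.
move=> hA; split=> [h V vV AV|h].
  by apply: integral_valuation h => //; apply: subring0.
apply: contrapT => nx.
have hJ : ideal A [set 0].
  split=> //.
  - by move=> _ ->; apply: subring0.
  - by move=> _ _ -> ->; rewrite /= addr0.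
  - by move=> a _ _ ->; rewrite /= mulr0.
have [|V [vV AV _ nV]] := not_integral_valuation hA hJ _ nx.
  by move=> _ ->; rewrite subr0; apply: ring_unit1.
by apply: nV; apply: h.
Qed.

(** Integrality is membership in all valuation rings above [A], so closure under the ring operations
    is inherited from these rings. *)
Lemma subring_integral A (F : set K) : subring A -> subring F ->
  subring (integral_closure A F).
Proof.
move=> hA hF; apply/subringP; split.
- split; first exact: subring1.
  by apply/integral_overP => // V [hV _] _; apply: subring1.
- move=> x y [Fx /(integral_overP _ hA) hx] [Fy /(integral_overP _ hA) hy].
  split; first exact: subringB.
  apply/integral_overP => // V vV AV; case: (vV) => hV _.
  by apply: subringB; [|apply: hx|apply: hy].
- move=> x y [Fx /(integral_overP _ hA) hx] [Fy /(integral_overP _ hA) hy].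
  split; first exact: subringM.
  apply/integral_overP => // V vV AV; case: (vV) => hV _.
  by apply: subringM; [|apply: hx|apply: hy].
Qed.

(** Otherwise [M + J] would be all of [A], and 1 = m + k would make m = 1 - k a unit in [M]. *)
Lemma maximal_ideal_jacobson A J M : subring A -> ideal A J ->
  (forall j, J j -> ring_unit A (1 - j)) -> maximal_ideal A M -> J `<=` M.
Proof.
move=> hA hJ uJ [hM M1 Mmax] j Jj.
have [JA J0 JD JM] := hJ; have [MA M0 MD MM] := hM.
have hI : ideal A [set z | exists m k, [/\ M m, J k & z = m + k]].
  split.
  - by move=> _ [m [k [/MA Mm /JA Jk ->]]]; apply: subringD.
  - by exists 0, 0; rewrite addr0.
  - move=> _ _ [m [k [Mm Jk ->]]] [m' [k' [Mm' Jk' ->]]].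
    by exists (m + m'), (k + k'); rewrite addrACA; split; [apply: MD|apply: JD|].
  - move=> a _ Aa [m [k [Mm Jk ->]]].
    by exists (a * m), (a * k); rewrite mulrDr; split; [apply: MM|apply: JM|].
have [|e|e] := Mmax _ hI.
- by move=> m Mm; exists m, 0; rewrite addr0.
- by rewrite -e; exists 0, j; rewrite add0r.
- have : A 1 by apply: subring1.
  rewrite -e => -[m [k [Mm Jk e1]]]; case: M1.
  have [u0 Au] := uJ _ Jk.
  rewrite -(mulVf u0) {2}e1 addrK; exact: MM.
Qed.

End MaximalExcluding.

(** * The rings [A_V] and [R] *)

Section Localization.
Context {K : fieldType}.
Implicit Types (A B P V W : set K).

(** Modulo [P] every element of V[m_D] comes from [V], so [B / P] is a quotient of the residue field
    of [V]. This is why localizing at [P] gives a local ring once [P] is proper. *)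
Lemma A_of_decomp D V : localr V -> subring D -> max_of D `<=` D ->
  let B := ring_gen (V `|` max_of D) in
  let P := ideal_gen B (max_of V `|` max_of D) in
  forall b, B b -> exists v p, [/\ V v, P p & b = v + p].
Proof.
move=> lV hD mD B P b Bb; have [hV _] := lV.
have hB : subring B := subring_ring_gen _.
have SB : max_of V `|` max_of D `<=` B.
  move=> x [|mx]; last by apply: sub_ring_gen; right.
  by rewrite max_of_localr // => -[Vx _]; apply: sub_ring_gen; left.
have hP : ideal B P := ideal_gen_ideal hB SB.
have [PB P0 PD PM] := hP.
suff [] : (B `&` [set b | exists v p, [/\ V v, P p & b = v + p]]) b by [].
have VB v : V v -> B v by move=> Vv; apply: sub_ring_gen; left.
apply: (@ring_gen_min _ (V `|` max_of D) _ _ _ b Bb).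
  apply/subringP; split.
  - split; first exact: subring1.
    by exists 1, 0; rewrite addr0; split=> //; apply: subring1.
  - move=> x y [Bx [v [p [Vv Pp xE]]]] [By [w [q [Vw Pq yE]]]].
    split; first exact: subringB hB Bx By.
    exists (v - w), (p - q); split; [exact: subringB|exact: (idealB hB hP)|].
    by rewrite xE yE opprD addrACA.
  - move=> x y [Bx [v [p [Vv Pp xE]]]] [By [w [q [Vw Pq yE]]]].
    split; first exact: subringM hB Bx By.
    exists (v * w), (v * q + y * p); split; first exact: subringM.
      by apply: PD; apply: PM => //; apply: VB.
    by rewrite xE {1}yE yE; ring.
move=> x [Vx|mx]; split.
- exact: VB.
- by exists x, 0; rewrite addr0.
- by apply: sub_ring_gen; right.
- exists 0, x; rewrite add0r; split=> //; first exact: subring0.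
  by apply: sub_ideal_gen; right.
Qed.

End Localization.

Section Main.
Context {K : fieldType}.
Variables (E D D' : set K).
Hypothesis norm : forall g : {poly K}, g != 0 ->
  exists g', g' != 0 /\ coefs_in E (g * g').
Hypothesis E_subring : subring E.
Hypothesis E_inv : forall x, E x -> E x^-1.
Hypothesis D_localr : localr D.
Hypothesis D_frac : quotient_field D = setT.
Hypothesis D'_subring : subring D'.
Hypothesis D'_sub : D' `<=` D.
Hypothesis D'_frac : quotient_field D' = E.
Hypothesis mD'_sub : max_of D' `<=` max_of D.
Hypothesis D_bigcap : \bigcap_(V in dominating_valuation D') A_of D V = D.

Local Notation A_ := (A_of D).
Local Notation dom := (dominating_valuation D').
Local Notation mD := (max_of D).
Local Notation R := (Kr_family (maximal_excluding_family D D')).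
Local Notation Dbar := (normalization D).
Local Notation tk c := (tofrac c%:P).

Implicit Types (V W : set K) (f g : {poly K}) (x y c d : K).
Implicit Types (T Om : set {fraction {poly K}}).

Let D_subring : subring D. Proof. by case: D_localr. Qed.

Let mDE : mD = nonunits D. Proof. exact: max_of_localr. Qed.

Let mD_sub : mD `<=` D. Proof. by rewrite mDE => x []. Qed.

Let E_div x y : E x -> E y -> E (x / y).
Proof. by move=> Ex Ey; apply: subringM => //; apply: E_inv. Qed.

Lemma domP V : dom V ->
  [/\ localr V, V `<=` E, D' `<=` V, max_of D' `<=` nonunits V
    & forall x, E x -> V x \/ V x^-1].
Proof.
move=> [[[hV DV VE] vV] mV]; have lV := valuation_ring_localr vV.
rewrite (max_of_localr lV) in mV; rewrite D'_frac in VE; split=> // x Ex.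
case: vV => _; apply; apply: (quotient_fieldS DV).
by rewrite D'_frac.
Qed.

(** * The local rings [A_V] *)

Section AV.
Variable V : set K.
Hypothesis domV : dom V.

Let B := ring_gen (V `|` mD).
Let P := ideal_gen B (max_of V `|` mD).

Let lV : localr V. Proof. by case: (domP domV). Qed.
Let hV : subring V. Proof. by case: lV. Qed.
Let hB : subring B. Proof. exact: subring_ring_gen. Qed.
Let VB : V `<=` B. Proof. by move=> x Vx; apply: sub_ring_gen; left. Qed.
Let hP : ideal B P.
Proof.
apply: ideal_gen_ideal => // x [|mx]; last by apply: sub_ring_gen; right.
by rewrite max_of_localr // => -[Vx _]; apply: VB.
Qed.
Let decomp b : B b -> exists v p, [/\ V v, P p & b = v + p].
Proof. exact: A_of_decomp. Qed.

Lemma D_sub_A_of : D `<=` A_ V.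
Proof. by rewrite -{1}D_bigcap => x; apply. Qed.

(** If [P] were the whole ring, the localization would have no denominators and be empty, but
    [D_bigcap] puts [D] inside it. *)
Let P1 : ~ P 1.
Proof.
move=> P1; have [a [s [_ Bs Ps _ _]]] := D_sub_A_of (subring1 D_subring).
by apply: Ps; rewrite -/B -/P (ideal_full hP P1).
Qed.

Let unitP v : V v -> ~ P v -> ring_unit V v.
Proof.
move=> Vv Pv; apply: contrapT => nu; apply: Pv; apply: sub_ideal_gen; left.
by rewrite max_of_localr.
Qed.

(** The components in [V] of two elements outside [P] are units of [V]. Their product is congruent
    to [x * y] modulo [P], so it would be a unit inside [P]. *)
Let P_mul x y : B x -> B y -> P (x * y) -> P x \/ P y.
Proof.
have [PB P0 PD PM] := hP.
move=> Bx By Pxy; apply: contrapT => /not_orP[Px Py].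
have [v [p [Vv Pp xE]]] := decomp Bx; have [w [q [Vw Pq yE]]] := decomp By.
have uv : ring_unit V v by apply: unitP => // Pv; apply: Px; rewrite xE; apply: PD.
have uw : ring_unit V w by apply: unitP => // Pw; apply: Py; rewrite yE; apply: PD.
have [u0 Vu] := ring_unitM hV uv uw.
apply: P1; rewrite -(mulVf u0); apply: (PM); first exact: VB.
have -> : v * w = x * y - (v * q + y * p) by rewrite xE yE; ring.
apply: (idealB hB hP) => //; apply: PD; apply: PM => //; exact: VB.
Qed.

Let neq0P s : ~ P s -> s != 0.
Proof. by move=> Ps; apply/eqP => s0; apply: Ps; rewrite s0; case: hP. Qed.

Let A_ofP x : A_ V x <-> exists a s, [/\ B a, B s, ~ P s & x = a / s].
Proof.
split=> [[a [s [Ba Bs Ps s0 ->]]]|[a [s [Ba Bs Ps ->]]]]; exists a, s => //.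
by split=> //; apply: neq0P.
Qed.

Lemma A_of_subring : subring (A_ V).
Proof.
have B1 : B 1 by apply: subring1.
have PM s t : B s -> B t -> ~ P s -> ~ P t -> ~ P (s * t).
  by move=> Bs Bt Ps Pt /(P_mul Bs Bt)[].
apply/subringP; split.
- by apply/A_ofP; exists 1, 1; rewrite divr1.
- move=> _ _ /A_ofP[a [s [Ba Bs Ps ->]]] /A_ofP[b [t [Bb Bt Pt ->]]].
  apply/A_ofP; exists (a * t - b * s), (s * t).
  rewrite subf_div ?neq0P //; split; [|exact: (subringM hB)|exact: PM|by []].
  by apply: (subringB hB); apply: (subringM hB).
- move=> _ _ /A_ofP[a [s [Ba Bs Ps ->]]] /A_ofP[b [t [Bb Bt Pt ->]]].
  apply/A_ofP; exists (a * b), (s * t).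
  by rewrite invfM mulrACA; split; [apply: (subringM hB)|apply: (subringM hB)|apply: PM|].
Qed.

Lemma A_of_unit a s : B a -> B s -> ~ P s -> ~ P a -> ring_unit (A_ V) (a / s).
Proof.
move=> Ba Bs Ps Pa; split.
  by rewrite mulf_neq0 ?invr_eq0 ?neq0P.
by apply/A_ofP; exists s, a; rewrite invf_div.
Qed.

Lemma A_of_localr : localr (A_ V).
Proof.
split; first exact: A_of_subring.
move=> _ /A_ofP[a [s [Ba Bs Ps ->]]].
have [Pa|Pa] := pselect (P a); last by left; apply: A_of_unit.
right; have -> : 1 - a / s = (s - a) / s by rewrite mulrBl divff ?neq0P.
apply: A_of_unit => //; first exact: (subringB hB).
move=> Psa; apply: Ps; rewrite -(subrK a s).
by case: hP => _ _ + _; apply.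
Qed.

Lemma V_sub_A_of : V `<=` A_ V.
Proof.
move=> x Vx; apply/A_ofP; exists x, 1; rewrite divr1.
by split=> //; [apply: VB|apply: subring1].
Qed.

Lemma mD_A_of : mD `<=` nonunits (A_ V).
Proof.
move=> x mx; split; first by apply/D_sub_A_of/mD_sub.
move=> [x0 /A_ofP[a [s [Ba Bs Ps e]]]]; apply: (Ps).
have -> : s = a * x.
  move: e => /(congr1 (fun z => z * x * s)).
  rewrite /= mulVf // mul1r => ->.
  by rewrite mulrAC (divfK (neq0P Ps)).
by case: hP => _ _ _; apply=> //; apply: sub_ideal_gen; right.
Qed.

(** A denominator is a unit of [V] plus an element of [P], so it stays a unit in [W]. Thus [A_V] is
    the least local ring that dominates [V] and has [mD] among its nonunits. *)
Lemma A_of_min W : localr W -> V `<=` W -> nonunits V `<=` nonunits W ->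
  mD `<=` nonunits W -> A_ V `<=` W /\ nonunits (A_ V) `<=` nonunits W.
Proof.
move=> lW VW mV mDW; have hN := nonunits_ideal lW; have [hW _] := lW.
have [NW N0 ND NM] := hN.
have BW : B `<=` W.
  by apply: ring_gen_min => // x [/VW//|/mDW[]].
have PN : P `<=` nonunits W.
  suff h : P `<=` B `&` nonunits W by move=> x /h[].
  apply: ideal_gen_min.
    split.
    - by move=> x [].
    - by split=> //; apply: subring0.
    - by move=> x y [? ?] [? ?]; split; [apply: (subringD hB)|apply: ND].
    - by move=> a x Ba [? ?]; split; [apply: (subringM hB)|apply: NM => //; apply: BW].
  move=> x [|mx]; last by split; [apply: sub_ring_gen; right|apply: mDW].
  by rewrite max_of_localr // => Nx; split; [case: Nx => /VB|apply: mV].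
have uW s : B s -> ~ P s -> ring_unit W s.
  move=> Bs Ps; have [v [p [Vv Pp sE]]] := decomp Bs.
  have uv : ring_unit V v.
    by apply: unitP => // Pv; apply: Ps; rewrite sE; case: hP => _ _ + _; apply.
  by rewrite sE; apply: ring_unitD => //; [apply: VW|apply: ring_unitS uv|apply: PN].
split=> [_ /A_ofP[a [s [Ba Bs Ps ->]]]|x [/A_ofP[a [s [Ba Bs Ps ->]]] nu]].
  by apply: subringM; [by []|apply: BW|case: (uW s Bs Ps)].
have Pa : P a by apply: contrapT => Pa; apply: nu; apply: A_of_unit.
by rewrite mulrC; apply: NM; [case: (uW s Bs Ps)|apply: PN].
Qed.

Lemma A_of_gen (T : set K) : subring T -> V `<=` T -> mD `<=` T ->
  (forall x, T x -> ring_unit (A_ V) x -> T x^-1) -> A_ V `<=` T.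
Proof.
move=> hT VT mT Tinv _ /A_ofP[a [s [Ba Bs Ps ->]]].
have BT : B `<=` T by apply: ring_gen_min => // x [/VT|/mT].
apply: subringM => //; first exact: BT.
apply: Tinv; first exact: BT.
rewrite -(divr1 s); apply: A_of_unit => //; exact: subring1.
Qed.

End AV.

(** * [R] as the intersection of the rings A_V(t) *)

Lemma frac_E h : exists f g, [/\ g != 0, coefs_in E g & h = f :/: g].
Proof.
have [f [g [g0 ->]]] := fracW h; have [g' [g'0 hg]] := norm g0.
exists (f * g'), (g * g'); split=> //; first by rewrite mulf_neq0.
rewrite !tofracM invfM mulrACA divff ?mulr1 //; by rewrite tofrac_eq0.
Qed.

Lemma scale_dom V g : dom V -> coefs_in E g -> g != 0 ->
  exists2 i, g`_i != 0 & prim V ((g`_i)^-1 *: g).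
Proof. by move=> /domP[[hV _] _ _ _ hv] hg g0; apply: scale_prim hg g0. Qed.

Lemma frac_prim V h : dom V -> exists f g, prim V g /\ h = f :/: g.
Proof.
move=> dV; have [f [g [g0 hg ->]]] := frac_E h.
have [i gi0 pg] := scale_dom dV hg g0.
by exists ((g`_i)^-1 *: f), ((g`_i)^-1 *: g); rewrite divZ ?invr_neq0.
Qed.

(** A coefficient of the numerator outside [A_V] is excluded by some maximal excluding [A] above
    [A_V]. This [A] belongs to the family, is local, and keeps [g] primitive, so [nagata_num] puts
    the coefficient back in [A], a contradiction. *)
Lemma RP h : R h <-> forall V, dom V -> nagata (A_ V) h.
Proof.
split=> [Rh V dV|hV A [ovA _ [V dV VA]]]; last first.
  by apply: nagataS VA _ (hV V dV); [apply: A_of_localr|case: ovA].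
have [f [g [pg e]]] := frac_prim h dV; have lA := A_of_localr dV.
have pAg := primS (V_sub_A_of dV) pg.
rewrite e; apply: nagata_div => //; first by case: lA.
move=> j; apply: contrapT => nfj.
have [A [hA VA nAfj Amax]] := maximal_excluding_above (A_of_subring dV) nfj.
have lAA : localr A := maximal_excluding_localr hA nAfj Amax.
have DA : D `<=` A by apply: subset_trans VA; apply: D_sub_A_of.
have full : quotient_field A = setT.
  by apply/seteqP; split=> // x _; apply: (quotient_fieldS DA); rewrite D_frac.
have hA' : nagata A (f :/: g).
  rewrite -e; apply: Rh; split.
  - by split=> //; rewrite D_frac.
  - by exists f`_j; rewrite full; split=> // C [hC _ _]; apply: Amax.
  - by exists V.
have pA : prim A g := primS VA pAg.
by apply: nAfj; apply: (nagata_num lAA (proj1 pA) hA' (prim_neq0 pA)).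
Qed.

Lemma tkV c : tk c^-1 = (tk c)^-1.
Proof. exact: (fmorphV (@tofrac {poly K} \o @polyC K)). Qed.

Lemma tkM c d : tk (c * d) = tk c * tk d.
Proof. by rewrite polyCM tofracM. Qed.

Lemma tk_eq0 c : (tk c == 0) = (c == 0).
Proof. by rewrite tofrac_eq0 polyC_eq0. Qed.

Lemma R_subring : subring R.
Proof.
apply/subringP; split.
- by apply/RP => V dV; apply: subring1; apply/subring_nagata/A_of_localr.
- move=> x y /RP hx /RP hy; apply/RP => V dV.
  by apply: subringB; [apply/subring_nagata/A_of_localr|apply: hx|apply: hy].
- move=> x y /RP hx /RP hy; apply/RP => V dV.
  by apply: subringM; [apply/subring_nagata/A_of_localr|apply: hx|apply: hy].
Qed.

Lemma R_poly f : coefs_in D f -> R (tofrac f).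
Proof.
move=> hf; apply/RP => V dV; apply: nagata_tofrac; first exact: A_of_subring.
exact: coefs_inS (D_sub_A_of dV) hf.
Qed.

Lemma R_X : R (tofrac 'X).
Proof. by apply: R_poly; apply: coefs_inX. Qed.

Lemma R_const c : D c -> R (tk c).
Proof. by move=> Dc; apply: R_poly; apply: coefs_inC (subring0 D_subring) Dc. Qed.

(* Kronecker property: it forces every valuation over [R] to be Gaussian on
   polynomials over [F']. *)
Lemma R_coef_div g i : coefs_in E g -> g != 0 -> R (tk g`_i / tofrac g).
Proof.
move=> hg g0; apply/RP => V dV; have [k gk0 pg] := scale_dom dV hg g0.
rewrite -(@divZ _ (g`_k)^-1) ?invr_neq0 //.
have hA := A_of_subring dV; have VA := V_sub_A_of dV.
apply: nagata_div; [by []| |exact: primS pg].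
move=> j; rewrite coefZ coefC; case: ifP => _; last first.
  by rewrite mulr0; apply: subring0.
by apply: VA; have := pg.1 i; rewrite coefZ.
Qed.

(** * Rings containing [R] *)

Section Overring.
Variable T : set {fraction {poly K}}.
Hypothesis hT : subring T.
Hypothesis RT : R `<=` T.

Lemma subring_const : subring [set c | T (tk c)].
Proof.
apply/subringP; split=> /=.
- by rewrite tofrac1; apply: subring1.
- by move=> x y Tx Ty; rewrite polyCB tofracB; apply: subringB.
- by move=> x y Tx Ty; rewrite tkM; apply: subringM.
Qed.

Lemma poly_ideal I f : ideal T I -> coefs_in [set c | I (tk c)] f -> I (tofrac f).
Proof.
move=> hI hf; rewrite -(coefK f) poly_def rmorph_sum /=.
apply: (ideal_sum hI) => i _; rewrite -mul_polyC tofracM mulrC tofracXn.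
by case: hI => _ _ _; apply; [apply/subringX/RT/R_X|apply: hf].
Qed.

Lemma poly_over f : coefs_in [set c | T (tk c)] f -> T (tofrac f).
Proof. by apply: poly_ideal; apply: ideal_refl. Qed.

Lemma prim_inv V g : dom V -> (forall v, V v -> T (tk v)) -> prim V g ->
  T (tofrac g)^-1.
Proof.
move=> dV VT pg; have [hg [i [gi0 Vgi]]] := pg.
have [_ VE _ _ _] := domP dV.
have -> : (tofrac g)^-1 = tk (g`_i)^-1 * (tk g`_i / tofrac g).
  by rewrite mulrA -tkM mulVf // mul1r.
apply: (subringM hT); first exact: VT.
by apply/RT/R_coef_div; [apply: coefs_inS hg|apply: prim_neq0 pg].
Qed.

Lemma nagata_sub V : dom V -> (forall a, A_ V a -> T (tk a)) -> nagata (A_ V) `<=` T.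
Proof.
move=> dV AT h Ah; have [f [g [pg e]]] := frac_prim h dV.
have lA := A_of_localr dV; have pAg := primS (V_sub_A_of dV) pg.
rewrite e in Ah *; have hf := nagata_num lA pAg.1 Ah (prim_neq0 pAg).
apply: (subringM hT); first by apply: poly_over => i; apply: AT.
by apply: (prim_inv dV) pg => v Vv; apply/AT/V_sub_A_of.
Qed.

End Overring.

Lemma dom_of W : valuation W -> D `<=` W -> mD `<=` nonunits W -> dom (W `&` E).
Proof.
move=> [hW hw] DW mW.
have hV : subring (W `&` E).
  apply/subringP; split; first by split; apply: subring1.
  - by move=> x y [? ?] [? ?]; split; apply: subringB.
  - by move=> x y [? ?] [? ?]; split; apply: subringM.
have D'E : D' `<=` E.
  by rewrite -D'_frac; apply: quotient_field_sub.
have vV : valuation_ring (W `&` E).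
  split=> // x [a [s [[_ Ea] [_ Es] _ ->]]].
  have Eas := E_div Ea Es.
  by case: (hw (a / s)) => h; [left|right]; split=> //; apply: E_inv.
split; first (split=> //; split=> //).
- by move=> x D'x; split; [apply/DW/D'_sub|apply: D'E].
- by move=> x [_ Ex]; rewrite D'_frac.
- move=> x mx; rewrite (max_of_localr (valuation_ring_localr vV)).
  have [Wx nx] := mW _ (mD'_sub mx).
  split; last by move=> /(ring_unitS (@subIsetl _ W E)).
  by split=> //; apply: D'E; case: mx => M [[+ _ _ _] _ _] Mx; apply.
Qed.
Lemma valuation_over : exists W, [/\ valuation W, D `<=` W & mD `<=` nonunits W].
Proof.
apply: chevalley => // h1; apply: (nonunits1 D_subring).
by apply: (ideal_gen_min (nonunits_ideal D_localr) _ h1); rewrite mDE.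
Qed.

(** [Jac_unit] needs at least one [V] to see that [1 - j] is nonzero. *)
Lemma dom_exists : exists V, dom V.
Proof. by have [W [vW DW mW]] := valuation_over; exists (W `&` E); apply: dom_of. Qed.

(** The common contraction of the maximal ideals of all A_V(t). It lies in every maximal ideal of
    [R], because [1 - j] is inverted in each A_V(t) and hence in [R]. It also contains [mD], so a
    valuation ring above [R] with [Jac] among its nonunits induces a member of the family. *)
Definition Jac := [set j | R j /\ forall V, dom V -> nonunits (nagata (A_ V)) j].

Lemma Jac_ideal : ideal R Jac.
Proof.
have N V : dom V -> ideal (nagata (A_ V)) (nonunits (nagata (A_ V))).
  by move=> dV; apply/nonunits_ideal/localr_nagata/A_of_localr.
split.
- by move=> j [].
- by split=> [|V /N[]//]; apply: subring0; apply: R_subring.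
- move=> x y [Rx hx] [Ry hy]; split=> [|V dV]; first exact: (subringD R_subring).
  by case: (N V dV) => _ _ + _; apply; [apply: hx|apply: hy].
- move=> a x Ra [Rx hx]; split=> [|V dV]; first exact: (subringM R_subring).
  by case: (N V dV) => _ _ _; apply; [move/RP: Ra; apply|apply: hx].
Qed.

Lemma Jac_unit j : Jac j -> ring_unit R (1 - j).
Proof.
move=> [Rj hj].
have u V : dom V -> ring_unit (nagata (A_ V)) (1 - j).
  move=> dV; apply: local_ring_unit1B; last exact: hj.
  exact/localr_nagata/A_of_localr.
split; first by have [V dV] := dom_exists; case: (u V dV).
by apply/RP => V /u[].
Qed.

Lemma mD_Jac x : mD x -> Jac (tk x).
Proof.
move=> mx; split; first by apply/R_const/mD_sub.
move=> V dV; have lA := A_of_localr dV; case: (lA) => hA _.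
rewrite -(divr1 (tk x)) -tofrac1.
have nx := mD_A_of dV mx.
apply/(localr_nonunits_nagataP lA); [|exact: prim1|].
  by apply: coefs_inC; [apply: subring0|case: nx].
by apply: coefs_inC => //; case: (nonunits_ideal lA).
Qed.

(** * Valuation rings above [R] and their traces on constants *)

Section Gaussian.
Variable Om : set {fraction {poly K}}.
Hypothesis vOm : valuation Om.
Hypothesis R_Om : R `<=` Om.
Hypothesis Jac_Om : Jac `<=` nonunits Om.

Let W := [set c | Om (tk c)].
Let V := W `&` E.

Let Om_subring : subring Om. Proof. by case: vOm. Qed.

Lemma center_valuation : valuation W.
Proof.
split; first exact: subring_const Om_subring.
by move=> c; rewrite /W /= tkV; case: vOm => _; apply.
Qed.

Lemma center_D : D `<=` W.
Proof. by move=> c Dc; apply/R_Om/R_const. Qed.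

Lemma center_nonunit c : nonunits Om (tk c) <-> nonunits W c.
Proof.
rewrite /nonunits /ring_unit /= tk_eq0 -tkV; split=> -[Oc n]; split=> //.
Qed.

Lemma center_mD : mD `<=` nonunits W.
Proof. by move=> c mc; apply/center_nonunit/Jac_Om/mD_Jac. Qed.

Lemma center_dom : dom V.
Proof. by apply: dom_of; [exact: center_valuation|exact: center_D|exact: center_mD]. Qed.

Lemma center_A_of : A_ V `<=` W /\ nonunits (A_ V) `<=` nonunits W.
Proof.
apply: (A_of_min center_dom) => //.
- exact/valuation_localr/center_valuation.
- exact: subIsetl.
- by move=> x [[Wx Ex] nx]; split=> // -[x0 Wx']; apply: nx; split=> //; split=> //; apply: E_inv.
- exact: center_mD.
Qed.

Lemma nagata_Om : nagata (A_ V) `<=` Om.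
Proof. by apply: nagata_sub center_dom _ => // a /center_A_of.1. Qed.

(** With [nagata_Om] this says that [Om] dominates A_V(t): the coefficients of the numerator of a
    nonunit are nonunits of [Om], the indeterminate lies in [R], and [prim_inv] puts the inverse of
    the denominator in [Om]. *)
Lemma nonunits_nagata_Om : nonunits (nagata (A_ V)) `<=` nonunits Om.
Proof.
move=> h Nh; have dV := center_dom; have lA := A_of_localr dV.
have [f [g [pg e]]] := frac_prim h dV.
have pAg := primS (V_sub_A_of dV) pg.
have hf : coefs_in (A_ V) f.
  by apply: (nagata_num lA pAg.1) (prim_neq0 pAg); rewrite -e; case: Nh.
rewrite e in Nh *; have nf := (localr_nonunits_nagataP lA hf pAg).1 Nh.
have hN := nonunits_ideal (valuation_localr vOm).
rewrite mulrC; case: (hN) => _ _ _; apply.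
  by apply: (prim_inv Om_subring R_Om dV) pg => v [].
apply: (poly_ideal Om_subring R_Om hN) => i; apply/center_nonunit.
by apply: center_A_of.2.
Qed.

End Gaussian.

(** * Integral closure of [D] and centres of valuation rings *)

Lemma DbarP x : Dbar x <-> integral_over D x.
Proof. by rewrite /normalization D_frac; split=> [[]|]. Qed.

Lemma Dbar_subring : subring Dbar.
Proof.
rewrite /normalization D_frac; apply: subring_integral => //.
by apply/subringP; split.
Qed.

Lemma D_Dbar : D `<=` Dbar.
Proof. by move=> x Dx; apply/DbarP/integral_overP => // W _; apply. Qed.

Lemma Dbar_sub W : valuation W -> D `<=` W -> Dbar `<=` W.
Proof. by move=> vW DW x /DbarP/(integral_overP _ D_subring); apply. Qed.

(** [J] collects the elements of [Dbar] that are nonunits in all valuation rings dominating [D].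
    Each 1 - j is a unit in all of these, and they detect integrality by [not_integral_valuation],
    so its inverse lies in [Dbar]. *)
Lemma mD_center M : maximal_ideal Dbar M -> mD `<=` M.
Proof.
pose J := [set x | Dbar x /\ forall W, valuation W -> D `<=` W ->
  mD `<=` nonunits W -> nonunits W x].
have hD := Dbar_subring.
have hJ : ideal Dbar J.
  split.
  - by move=> x [].
  - split; first exact: subring0.
    by move=> W vW _ _; case: (nonunits_ideal (valuation_localr vW)).
  - move=> x y [Dx hx] [Dy hy]; split=> [|W vW DW mW]; first exact: (subringD hD).
    by case: (nonunits_ideal (valuation_localr vW)) => _ _ + _; apply; [apply: hx|apply: hy].
  - move=> a x Da [Dx hx]; split=> [|W vW DW mW]; first exact: (subringM hD).
    case: (nonunits_ideal (valuation_localr vW)) => _ _ _; apply; last exact: hx.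
    exact: (Dbar_sub vW).
have uJ j : J j -> ring_unit Dbar (1 - j).
  move=> [Dj hj]; have u W : valuation W -> D `<=` W -> mD `<=` nonunits W -> ring_unit W (1 - j).
    by move=> vW DW mW; apply: local_ring_unit1B (valuation_localr vW) _; apply: hj.
  split; first by have [W [vW DW mW]] := valuation_over; case: (u W vW DW mW).
  apply/DbarP; apply: contrapT => ni.
  have hN := nonunits_ideal D_localr.
  have [|W [vW DW NW]] := not_integral_valuation D_subring hN _ ni.
    by move=> i; apply: local_ring_unit1B.
  by apply; case: (u W vW DW) => //; rewrite mDE.
move=> hM; apply: subset_trans (maximal_ideal_jacobson hD hJ uJ hM).
by move=> x mx; split=> [|W _ _]; [apply/D_Dbar/mD_sub|apply].
Qed.

(** An ideal not contained in the centre has an element [y] that is a unit of [W]. Modulo the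
    centre, an integral equation of [y] over [D] may be divided by [y] until its constant term is
    invertible; that term is then a multiple of [y], so the ideal contains a unit. *)
Lemma center_maximal W : valuation W -> D `<=` W -> mD `<=` nonunits W ->
  maximal_ideal Dbar (max_of W `&` Dbar).
Proof.
move=> vW DW mW; have lW := valuation_localr vW; rewrite max_of_localr //.
have hD := Dbar_subring; have hN := nonunits_ideal lW; have [NW N0 ND NM] := hN.
have DbW := Dbar_sub vW DW.
split.
- split.
  + by move=> x [].
  + by split=> //; apply: subring0.
  + by move=> x y [? ?] [? ?]; split; [apply: ND|apply: (subringD hD)].
  + by move=> a x Da [? ?]; split; [apply: NM => //; apply: DbW|apply: (subringM hD)].
- by move=> [/nonunits1 h _]; apply: h; case: lW.
move=> I hI MI; have [IM|nIM] := pselect (I `<=` nonunits W `&` Dbar).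
  by left; apply/seteqP.
right; apply: (ideal_full hI); have [ID I0 IA IMul] := hI.
have [y Iy uy] : exists2 y, I y & ring_unit W y.
  apply: contrapT => h; apply: nIM => y Iy; have Dy := ID _ Iy.
  by split=> //; split; [apply: DbW|move=> uy; apply: h; exists y].
have Dy := ID _ Iy.
have poly_Dbar q : coefs_in D q -> Dbar q.[y].
  move=> hq; rewrite horner_coef; apply: (subring_sum hD) => i _.
  by apply: (subringM hD); [apply: D_Dbar|apply: (subringX _ hD)].
have /DbarP[p [mp /(polyOver_coefs_in _ (subring0 D_subring)) hp /rootP py]] := Dy.
(* The root condition is weakened to [q.[y]] being a nonunit of [W], a form that survives the
   division by [y] passing from [q] to [r]. *)
suff main n (q : {poly K}) : (size q <= n)%N -> q \is monic -> coefs_in D q ->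
    nonunits W q.[y] -> I 1.
  by apply: (main _ p (leqnn _)); rewrite ?py.
elim: n q => [|n IH] q.
  by rewrite leqn0 size_poly_eq0 => /eqP-> /monic_neq0; rewrite eqxx.
move=> sq mq hq nq.
have q0 := monic_neq0 mq.
have [s1|s1] := leqP (size q) 1.
  have q1 : q = 1 by have := monicP mq; rewrite (size1_polyC s1) lead_coefC => ->.
  by case: (nonunits1 lW.1); rewrite q1 hornerC in nq.
pose r := drop_poly 1 q.
have qE : q = r * 'X + (q`_0)%:P.
  apply/polyP => i; rewrite coefD coefMX coefC coef_drop_poly.
  by case: i => [|i]; rewrite ?add0r ?addr0 ?addn1.
have hr : coefs_in D r by move=> i; rewrite coef_drop_poly.
have sr : size r = (size q).-1 by rewrite size_drop_poly subn1.
have mr : r \is monic.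
  rewrite monicE lead_coefE sr coef_drop_poly addn1.
  by have := monicP mq; rewrite lead_coefE => <-; rewrite prednK // -subn1 subn_gt0.
have Dq0 := hq 0%N.
have e : q.[y] = y * r.[y] + q`_0 by rewrite {1}qE hornerD hornerM hornerX hornerC mulrC.
have [uc|nc] := pselect (ring_unit D q`_0).
  case: uc => c0 Dc; rewrite -(mulVf c0); apply: (IMul); first exact: D_Dbar.
  have -> : q`_0 = q.[y] - r.[y] * y by rewrite e mulrC addrC addKr.
  apply: (idealB hD hI); last by apply: IMul => //; apply: poly_Dbar.
  by apply: MI; split=> //; apply: poly_Dbar.
apply: (IH r) => //; first by rewrite sr -ltnS prednK // size_poly_gt0.
have [y0 Wy] := uy.
have -> : r.[y] = y^-1 * (q.[y] - q`_0) by rewrite e addrK mulKf.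
apply: NM => //; apply: (idealB lW.1 hN) => //.
by apply: mW; rewrite mDE.
Qed.

(** * Integral closure and localizations of [R] *)

Lemma full_quotient W : D `<=` W -> quotient_field W = setT.
Proof.
by move=> DW; apply/seteqP; split=> // x _; apply: (quotient_fieldS DW); rewrite D_frac.
Qed.

Lemma R_frac : quotient_field R = setT.
Proof.
have common f : exists2 d, D d /\ d != 0 & coefs_in D (d *: f).
  elim/poly_ind: f => [|f c [d [Dd d0] hf]].
    exists 1; first by split; [apply: subring1|apply: oner_neq0].
    by rewrite scaler0 => i; rewrite coef0; apply: subring0.
  have : quotient_field D c by rewrite D_frac.
  move=> [a [s [Da Ds s0 ->]]]; exists (d * s); first by split; [apply: subringM|apply: mulf_neq0].
  move=> i; rewrite coefZ coefD coefMX coefC mulrDr.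
  apply: subringD => //; case: i => [|i] /=.
  - by rewrite mulr0; apply: subring0.
  - by rewrite mulrAC -coefZ; apply: subringM.
  - by rewrite -mulrA (mulrC s) divfK //; apply: subringM.
  - by rewrite mulr0; apply: subring0.
apply/seteqP; split=> // h _; have [f [g [g0 ->]]] := fracW h.
have [d [Dd d0] hf] := common f; have [c [Dc c0] hg] := common g.
exists (tofrac (c *: (d *: f))), (tofrac (d *: (c *: g))); split.
- by apply: R_poly; apply: coefs_inZ.
- by apply: R_poly; apply: coefs_inZ.
- by rewrite tofrac_eq0 !scale_poly_eq0 (negPf d0) (negPf c0).
- by rewrite !scalerA (mulrC d c) divZ // mulf_neq0.
Qed.

(** A Gauss extension W(t) is a valuation ring containing A_V(t) for the trace V of W on F', hence
    it contains [R] and everything integral over it. Conversely, a ring [Om] that omits a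
    nonintegral [h] has a trace W on F, and an [h] in W(t) would lie in [Om]. *)
Lemma normalization_R : normalization R = Kr Dbar.
Proof.
apply/seteqP; split=> h.
  move=> [_ ih] W [[[hW DbW _] [_ vrW]] cW].
  have DW : D `<=` W by apply: subset_trans DbW; apply: D_Dbar.
  have vW : valuation W by split=> // x; apply: vrW; rewrite full_quotient.
  have mW : mD `<=` nonunits W.
    rewrite -(max_of_localr (valuation_localr vW)).
    by apply: subset_trans (mD_center cW) _ => x [].
  have dV := dom_of vW DW mW.
  apply: (integral_valuation (valuation_nagata vW)) ih.
    by apply: subring0; apply: R_subring.
  move=> r /RP/(_ _ dV); apply: nagataS => //; first exact: A_of_localr.
  have [] := A_of_min dV (valuation_localr vW) _ _ mW => //.
  by move=> x [[Wx Ex] nx]; split=> // -[x0 Wx']; apply: nx; split=> //; split=> //; apply: E_inv.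
move=> hK; split; first by rewrite R_frac.
apply: contrapT => ni.
have [Om [vOm ROm JOm nOm]] := not_integral_valuation R_subring Jac_ideal Jac_unit ni.
apply: nOm.
pose W := [set c | Om (tk c)].
have vW : valuation W by apply: center_valuation.
have DW : D `<=` W by apply: center_D.
have mW : mD `<=` nonunits W by apply: center_mD.
have dV : dom (W `&` E) by apply: center_dom.
have : nagata W h.
  apply: hK; split; last exact: center_maximal.
  have [hW hw] := vW; split; last by split=> // x _; apply: hw.
  split=> //; first exact: Dbar_sub.
  by rewrite full_quotient //; apply: D_Dbar.
have [f [g [pg ->]]] := frac_prim h dV => hfg.
have pW : prim W g by apply: primS pg => x [].
have hf := nagata_num (valuation_localr vW) pW.1 hfg (prim_neq0 pW).
have hOm : subring Om by case: vOm.
apply: (subringM hOm); first exact: (poly_over hOm ROm).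
by apply: (prim_inv hOm ROm dV) pg => v [].
Qed.

Lemma localization_R (p : set {fraction {poly K}}) : maximal_ideal R p ->
  exists V : set K,
    [/\ dom V, local_ring (nagata (A_ V)),
        p = max_of (nagata (A_ V)) `&` R
      & localization R p = nagata (A_ V)].
Proof.
move=> hp; have hR := R_subring.
have Jp := maximal_ideal_jacobson hR Jac_ideal Jac_unit hp.
have [ip p1 pmax] := hp; have [pR p0 pD pM] := ip.
have [|Om [vOm ROm pOm]] := chevalley hR pR.
  by move=> h; apply: p1; apply: (ideal_gen_min ip) h.
have JOm : Jac `<=` nonunits Om by apply: subset_trans pOm.
pose W := [set c | Om (tk c)]; pose V := W `&` E.
have dV : dom V by apply: center_dom.
have lA := A_of_localr dV; have lN := localr_nagata lA; have [hN _] := lN.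
have hOm : subring Om by case: vOm.
have NOm : nagata (A_ V) `<=` Om by apply: nagata_Om.
have RN : R `<=` nagata (A_ V) by move=> r /RP; apply.
have nOm : nonunits (nagata (A_ V)) `<=` nonunits Om by apply: nonunits_nagata_Om.
have pE : p = nonunits Om `&` R.
  have iO := nonunits_ideal (valuation_localr vOm); have [_ O0 OD OM] := iO.
  have hI : ideal R (nonunits Om `&` R).
    split.
    - by move=> x [].
    - by split=> //; apply: subring0.
    - by move=> x y [? ?] [? ?]; split; [apply: OD|apply: (subringD hR)].
    - by move=> a x Ra [? ?]; split; [apply: OM => //; apply: ROm|apply: (subringM hR)].
  have [|-> //|e] := pmax _ hI.
    by move=> x px; split; [apply: pOm|apply: pR].
  have [/nonunits1 h _] : (nonunits Om `&` R) 1 by rewrite e; apply: subring1.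
  by case: h.
have npP s : R s -> ~ p s -> ring_unit Om s.
  move=> Rs ps; apply: contrapT => us; apply: ps; rewrite pE.
  by split=> //; split=> //; apply: ROm.
have unit_np s : ring_unit Om s -> ~ p s by rewrite pE => us [[_]].
exists V; split=> //.
- exact: localr_local_ring.
- rewrite max_of_localr // pE; apply/seteqP; split=> r [nr Rr]; split=> //.
    split; first exact: RN.
    by move=> /(ring_unitS NOm); case: nr.
  exact: nOm.
(* An element of [R] that is a nonunit of A_V(t) is a nonunit of [Om], hence lies in [p]; so
   denominators outside [p] are invertible in A_V(t). *)
apply/seteqP; split=> [_ [a [s [Ra Rs ps s0 ->]]]|].
  apply: (subringM hN); first exact: RN.
  have [[] //|us] := pselect (ring_unit (nagata (A_ V)) s).
  by case: ps; rewrite pE; split=> //; apply: nOm; split=> //; apply: RN.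
pose S := localization R p.
have SP (h : {fraction {poly K}}) : S h <-> exists a s, [/\ R a, R s, ring_unit Om s & h = a / s].
  split=> [[a [s [Ra Rs ps s0 ->]]]|[a [s [Ra Rs us ->]]]]; exists a, s.
    by split=> //; apply: npP.
  by split=> //; [apply: unit_np|case: us].
have hS : subring S.
  apply/subringP; split.
  - apply/SP; exists 1, 1; rewrite divr1; split=> //; try exact: subring1.
    exact: ring_unit1.
  - move=> _ _ /SP[a [s [Ra Rs us ->]]] /SP[b [t [Rb Rt ut ->]]]; apply/SP.
    exists (a * t - b * s), (s * t); rewrite (subf_div _ _ us.1 ut.1); split=> //.
    + by apply: (subringB hR); apply: (subringM hR).
    + exact: (subringM hR).
    + exact: ring_unitM.
  - move=> _ _ /SP[a [s [Ra Rs us ->]]] /SP[b [t [Rb Rt ut ->]]]; apply/SP.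
    exists (a * b), (s * t); rewrite invfM mulrACA; split=> //.
    + exact: (subringM hR).
    + exact: (subringM hR).
    + exact: ring_unitM.
have RS : R `<=` S.
  move=> x Rx; apply/SP; exists x, 1; rewrite divr1; split=> //.
    exact: subring1.
  exact: ring_unit1.
have Sinv (x : {fraction {poly K}}) : S x -> ring_unit Om x -> S x^-1.
  move=> /SP[a [s [Ra Rs us ->]]] ux; apply/SP; exists s, a.
  rewrite invf_div; split=> //.
  have -> : a = a / s * s by rewrite divfK ?us.1.
  exact: ring_unitM.
have lOm := valuation_localr vOm.
have tk_unit c : ring_unit W c -> ring_unit Om (tk c).
  by move=> [c0 Wc]; split; rewrite ?tk_eq0 // -tkV.
have VS v : V v -> S (tk v).
  move=> [Wv Ev].
  (* For g = 1 + v t, both 1/g and v/g lie in [R] by [R_coef_div], and 1/g is a unit of [Om] because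
     [g] lies in [Om]. Their quotient is [v]. *)
  pose g : {poly K} := 1 + v *: 'X.
  have g0c : g`_0 = 1 by rewrite coefD coefZ coefX coefC mulr0 addr0.
  have g1c : g`_1 = v by rewrite coefD coefZ coefX coefC mulr1 add0r.
  have g0 : g != 0 by apply: contra_eq_neq g0c => ->; rewrite coef0 eq_sym oner_neq0.
  have hg (B : set K) : subring B -> B v -> coefs_in B g.
    move=> hB Bv i; rewrite coefD coefZ coefX coefC.
    apply: (subringD hB); last apply: (subringM hB) => //.
      by case: ifP => _; [apply: subring1|apply: subring0].
    by case: eqP => _; [apply: subring1|apply: subring0].
  have hW : subring W by apply: subring_const.
  have Og : Om (tofrac g) by apply: (poly_over hOm ROm); apply: hg.
  have Rg i : R (tk g`_i / tofrac g) by apply: R_coef_div => //; apply: hg.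
  have g'0 : tofrac g != 0 by rewrite tofrac_eq0.
  apply/SP; exists (tk g`_1 / tofrac g), (tk g`_0 / tofrac g); split=> //.
    rewrite g0c tofrac1 mul1r; split; first by rewrite invr_eq0.
    by rewrite invrK.
  by rewrite g0c g1c tofrac1 mul1r invrK divfK.
apply: (nagata_sub hS RS dV).
apply: (A_of_gen dV (T := [set c | S (tk c)])) => //.
- exact: subring_const.
- by move=> m mm; apply/RS/R_const/mD_sub.
- move=> c Sc uc; rewrite /= tkV; apply: Sinv => //.
  apply: tk_unit; apply: ring_unitS uc.
  by have [] := center_A_of vOm ROm JOm.
Qed.
End Main.

Theorem theorem5p8 (F0 : fieldType) (L : splittingFieldType F0)
    (n : nat) (theta : n.-tuple L) (D D' : set L)
    (* F = L, F' = 1%VS *)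
    (char0 : [pchar F0] =i pred0)
    (galF : galois 1%AS {:L}%AS)
    (degF : \dim {:L} = n)
    (theta_span : <<theta>>%VS = {:L}%VS)
    (theta1 : theta`_0 = 1)
    (* the local domain D with quotient field F *)
    (D_local : local_ring D)
    (D_frac : quotient_field D = setT)
    (D_dim : finite_krull_dim D)
    (inter : intermediate_condition (normalization D) (conjugate_field theta))
    (* the local integrally closed domain D' with quotient field F' *)
    (D'_local : local_ring D')
    (D'_frac : quotient_field D' = [set x | x \in 1%VS])
    (D'_dim : finite_krull_dim D')
    (D'_ic : integrally_closed D')
    (D'_rat : forall q : rat, D' (ratr q))
    (mD'_sub : max_of D' `<=` max_of D)
    (D_eq : D = localization (ring_gen (D' `|` max_of D)) (max_of D))
    (Dbar_eq1 : integral_closure D' setT = normalization D)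
    (Dbar_eq2 : normalization D = ring_gen (D `|` [set x | x \in theta]))
    (D_bigcap : \bigcap_(V in dominating_valuation D') A_of D V = D) :
  let R := Kr_family (maximal_excluding_family D D') in
  normalization R = Kr (normalization D) /\
  (forall p : set {fraction {poly L}}, maximal_ideal R p ->
     exists V : set L,
       [/\ dominating_valuation D' V,
           local_ring (nagata (A_of D V)),
           p = max_of (nagata (A_of D V)) `&` R
         & localization R p = nagata (A_of D V)]).
Proof.
have D_localr := local_ring_localr D_local.
have D'_subring : subring D' by case: D'_local.
have E_subring : subring [set x : L | x \in 1%VS].
  apply/subringP; split=> /=; first exact: (rpred1 1%AS).
  - by move=> x y Ex Ey; apply: rpredB.
  - by move=> x y Ex Ey; apply: rpredM.
have E_inv (x : L) : x \in 1%VS -> x^-1 \in 1%VS.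
  by move=> Ex; rewrite (rpredV 1%AS).
have D'_sub : D' `<=` D.
  move=> x D'x; rewrite D_eq; exists x, 1; rewrite divr1 oner_neq0; split=> //.
  - by apply: sub_ring_gen; left.
  - exact: subring1 (subring_ring_gen _).
  - by case=> M [_ M1 _] /M1.
split; first exact: (normalization_R (norm_poly galF) E_subring E_inv).
move=> p; exact: (localization_R (norm_poly galF) E_subring E_inv).
Qed.
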